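(* Every tame knot $K$ in $\mathbb{R}^3$ is equivalent to an origami knot. Moreover, for every tame knot $K$, the fold number of $K$ is at most the diagram stick number of $K$.
   Context: All knots are tame, and two knots in $\mathbb{R}^3$ are equivalent if they are ambient isotopic. A continuous map $F:[0,1]^2\to\mathbb{R}^3$ is piecewise-linear if $[0,1]^2$ can be subdivided into finitely many polygons on each of which $F$ is affine (in particular the image of $F$ is a union of polygons in $\mathbb{R}^3$). It is an arcwise isometry if for every path $p:[0,1]\to[0,1]^2$ the Euclidean arc length is preserved: $L(p)=L(F\circ p)$. For piecewise-linear maps this is equivalent to being a piecewise isometry. An origami folding is a piecewise-linear arcwise isometry $F:[0,1]^2\to\mathbb{R}^3$; it need not be injective, so the paper may self-intersect. The crease pattern of an origami folding $F$ is the (possibly empty) finite graph $G$ embedded in $[0,1]^2$ (with straight edges, since $F$ is piecewise-linear) such that $F$ is non-differentiable precisely on $G$. A knot $K$ is an origami knot if there exist a piecewise-linear simple closed curve (loop) $\ell:S^1\hookrightarrow[0,1]^2$ and an origami folding $F$ such that $F(\ell)=K$ (so $F\circ\ell$ is injective, parametrizing the knot $K$). In this case $F$ is said to admit $K$. The fold number of a knot $K$ is the minimum number of edges in a crease pattern of an origami folding which admits a knot $K'$ equivalent to $K$. The diagram stick number of a knot $K$ is the minimum number of line segments required to create a piecewise-linear knot diagram (in the plane) for $K$. *)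

(* Defs.v *)
From HB Require Import structures.
From mathcomp Require Export all_boot all_order all_algebra.
From mathcomp Require Export all_classical all_reals all_analysis.
Export Order.TTheory GRing.Theory Num.Theory numFieldNormedType.Exports.

Set Implicit Arguments.
Unset Strict Implicit.
Unset Printing Implicit Defensive.

Local Open Scope classical_set_scope.
Local Open Scope ring_scope.

(* ** Paths and loops.  The circle is [0, 1] with its endpoints identified. *)

Definition simple_loop (R : realType) (T : topologicalType) (c : R -> T) : Prop :=
  [/\ {within `[0, 1], continuous c},
      c 0 = c 1 &
      {in `[0, 1[ &, injective c}].

(* The breakpoints of c are 0 and the elements of s, the last of which is 1,
   so that size s is the number of pieces. *)
Definition affine_along (R : realType) (n : nat) (s : seq R)
    (c : R -> 'rV[R]_n) : Prop :=
  itv_partition 0 1 s /\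
  forall i, (i < size s)%N -> exists u v : 'rV[R]_n,
    forall t : R, t \in `[nth 0 (0 :: s) i, nth 0 s i] -> c t = u + t *: v.

Definition pl_simple_loop (R : realType) (n : nat) (c : R -> 'rV[R]_n) : Prop :=
  simple_loop c /\ exists s : seq R, affine_along s c.

Definition enorm (R : realType) (n : nat) (v : 'rV[R]_n) : R :=
  Num.sqrt (\sum_i v 0 i ^+ 2).

Definition arc_length (R : realType) (n : nat) (p : R -> 'rV[R]_n) : \bar R :=
  ereal_sup [set (\sum_(i < size s)
      enorm (p (nth 0 s i) - p (nth 0 (0 :: s) i)))%:E
    | s in itv_partition 0 1].

(* ** Knots *)

Definition knot (R : realType) (K : set 'rV[R]_3) : Prop :=
  exists2 c : R -> 'rV[R]_3, simple_loop c & K = c @` `[0, 1].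

Definition polygonal_knot (R : realType) (K : set 'rV[R]_3) : Prop :=
  exists2 c : R -> 'rV[R]_3, pl_simple_loop c & K = c @` `[0, 1].

Definition homeomorphism (T U : topologicalType) (f : T -> U) : Prop :=
  continuous f /\ exists g : U -> T, [/\ continuous g, cancel f g & cancel g f].

Definition ambient_isotopic (R : realType) (K L : set 'rV[R]_3) : Prop :=
  exists H : R -> 'rV[R]_3 -> 'rV[R]_3,
    [/\ {within `[0, 1] `*` setT,
          continuous (fun p : R * 'rV[R]_3 => H p.1 p.2)},
        forall t : R, t \in `[0, 1] -> homeomorphism (H t),
        H 0 =1 id &
        H 1 @` K = L].

Definition tame_knot (R : realType) (K : set 'rV[R]_3) : Prop :=
  knot K /\ exists2 L, polygonal_knot L & ambient_isotopic K L.

(* ** Origami foldings *)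

Definition unit_square (R : realType) : set 'rV[R]_2 :=
  [set x | forall i, x 0 i \in `[0, 1]].
Arguments unit_square R : clear implicits.

(* By the Jordan curve theorem, such a set is the closed region bounded by a
   simple closed polygonal curve: compactness excludes the unbounded side, and
   the nonempty interior excludes the curve itself. *)
Definition polygon (R : realType) (P : set 'rV[R]_2) : Prop :=
  [/\ compact P, interior P !=set0 &
      exists2 c : R -> 'rV[R]_2,
        pl_simple_loop c & closure P `\` interior P = c @` `[0, 1]].

Definition affine_on (R : realType) (m n : nat) (P : set 'rV[R]_m)
    (F : 'rV[R]_m -> 'rV[R]_n) : Prop :=
  exists (A : 'M[R]_(m, n)) (b : 'rV[R]_n), forall x, P x -> F x = x *m A + b.

(* A map on the square is a total function, of which only the values on the
   square matter. *)
Definition pl_on_square (R : realType) (F : 'rV[R]_2 -> 'rV[R]_3) : Prop :=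
  {within unit_square R, continuous F} /\
  exists Ps : seq (set 'rV[R]_2),
    [/\ forall i, (i < size Ps)%N -> polygon (nth set0 Ps i),
        forall i j, (i < size Ps)%N -> (j < size Ps)%N -> i != j ->
          interior (nth set0 Ps i) `&` interior (nth set0 Ps j) = set0,
        \bigcup_(i in `I_(size Ps)) nth set0 Ps i = unit_square R &
        forall i, (i < size Ps)%N -> affine_on (nth set0 Ps i) F].

Definition arcwise_isometry (R : realType) (F : 'rV[R]_2 -> 'rV[R]_3) : Prop :=
  forall p : R -> 'rV[R]_2,
    {within `[0, 1], continuous p} ->
    (forall t : R, t \in `[0, 1] -> unit_square R (p t)) ->
    arc_length p = arc_length (F \o p).

Definition origami_folding (R : realType) (F : 'rV[R]_2 -> 'rV[R]_3) : Prop :=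
  pl_on_square F /\ arcwise_isometry F.

(* Differentiability is relative to the square, so that points of its sides are
   not automatically points of non-differentiability. *)
Definition differentiable_in_square (R : realType)
    (F : 'rV[R]_2 -> 'rV[R]_3) (x : 'rV[R]_2) : Prop :=
  let N := within (unit_square R) (nbhs x) in
  exists A : 'M[R]_(2, 3),
    (fun y => F y - F x - (y - x) *m A) =o_N (fun y => y - x).

Definition closed_segment (R : realType) (e : 'rV[R]_2 * 'rV[R]_2) :
    set 'rV[R]_2 :=
  [set e.1 + t *: (e.2 - e.1) | t in `[0, 1]].

Definition open_segment (R : realType) (e : 'rV[R]_2 * 'rV[R]_2) :
    set 'rV[R]_2 :=
  [set e.1 + t *: (e.2 - e.1) | t in `]0, 1[].

(* Each edge is listed once, as the pair of its endpoints in either order. *)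
Record straight_graph (R : realType) := StraightGraph {
  vertices : seq 'rV[R]_2;
  edges : seq ('rV[R]_2 * 'rV[R]_2);
  edge_ends : forall e, e \in edges ->
    [/\ e.1 \in vertices, e.2 \in vertices & e.1 != e.2];
  edge_avoids_vertices : forall e v, e \in edges -> v \in vertices ->
    ~ open_segment e v;
  edges_disjoint : forall i j, (i < j < size edges)%N ->
    open_segment (nth (0, 0) edges i) `&` open_segment (nth (0, 0) edges j)
      = set0 }.

Definition graph_support (R : realType) (G : straight_graph R) :
    set 'rV[R]_2 :=
  [set x | x \in vertices G \/ exists2 e, e \in edges G & closed_segment e x].

Definition crease_pattern (R : realType) (F : 'rV[R]_2 -> 'rV[R]_3)
    (G : straight_graph R) : Prop :=
  graph_support G =
    [set x | unit_square R x /\ ~ differentiable_in_square F x].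

Definition admits (R : realType) (F : 'rV[R]_2 -> 'rV[R]_3)
    (K : set 'rV[R]_3) : Prop :=
  exists l : R -> 'rV[R]_2,
    [/\ pl_simple_loop l,
        forall t : R, t \in `[0, 1] -> unit_square R (l t),
        {in `[0, 1[ &, injective (F \o l)} &
        (F \o l) @` `[0, 1] = K].

Definition origami_knot (R : realType) (K : set 'rV[R]_3) : Prop :=
  exists2 F : 'rV[R]_2 -> 'rV[R]_3, origami_folding F & admits F K.

Definition is_minimum (S : set nat) (n : nat) : Prop :=
  S n /\ forall m, S m -> (n <= m)%N.

Definition is_fold_number (R : realType) (K : set 'rV[R]_3) : nat -> Prop :=
  is_minimum [set n | exists F G (L : set 'rV[R]_3),
    [/\ origami_folding F, crease_pattern F G, size (edges G) = n,
        admits F L & ambient_isotopic K L]].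

(* ** Diagrams *)

Definition double_point (R : realType) (d : R -> 'rV[R]_2) (t u : R) : Prop :=
  [/\ t \in `[0, 1[, u \in `[0, 1[, t != u & d t = d u].

(* A closed polygonal curve with n segments, all of whose multiple points are
   double points, finite in number, and away from the vertices (two segments
   crossing at such a point are not parallel, as they would otherwise overlap);
   over t u says that the strand through d t passes over the one through d u. *)
Record pl_diagram (R : realType) (n : nat) := PlDiagram {
  curve : R -> 'rV[R]_2;
  over : R -> R -> Prop;
  curve_continuous : {within `[0, 1], continuous curve};
  curve_closed : curve 0 = curve 1;
  curve_segments : exists2 s : seq R, size s = n &
    affine_along s curve /\
    forall t u, double_point curve t u -> t \notin 0 :: s;
  curve_no_triple : forall t u v,
    double_point curve t u -> double_point curve t v -> u = v;
  curve_finite : finite_set [set t | exists u, double_point curve t u];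
  over_xor : forall t u, double_point curve t u -> (over t u <-> ~ over u t) }.

Definition represents (R : realType) (n : nat) (D : pl_diagram R n)
    (K : set 'rV[R]_3) : Prop :=
  exists (c : R -> 'rV[R]_3) (h : R -> R),
    [/\ simple_loop c,
        forall t : R, t \in `[0, 1] ->
          c t = row_mx (curve D t) (h t)%:M :> 'rV_(2 + 1),
        forall t u, double_point (curve D) t u -> over D t u -> h u < h t &
        ambient_isotopic K (c @` `[0, 1])].

Definition is_diagram_stick_number (R : realType) (K : set 'rV[R]_3) :
    nat -> Prop :=
  is_minimum [set n | exists D : pl_diagram R n, represents D K].

(* Main.v *)
(* A polygonal knot projects, in all but finitely many directions of a suitable
   curve of directions, to a diagram in general position, so stick diagrams
   exist.  Conversely, cut a diagram with n segments at its vertex V of largest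
   norm and parametrize it by arc length on [0, 1] as g, with g 0 = g 1 = V.
   The folding F (x, y) = (g x, y) of the square, a cylinder over g, is creased
   along the vertical lines over the n - 1 other vertices where g really turns.
   Take the loop in the square that runs from left to right along the graph of a
   height function with the prescribed values at the crossings, and returns
   along a straight segment above it.  Folding that loop yields the knot of the
   diagram, except that the last bit of the diagram, along the last edge, is
   replaced by a lift of almost the whole diagram, traversed backwards with
   monotone height.  Because V is exposed, in each horizontal plane a linear
   shear fixing the other strand straightens this lift onto the last edge.
   Finally two height functions that agree at the crossings differ by a function
   of the point of the plane, which Tietze's theorem extends to a vertical
   isotopy. *)

From mathcomp Require Import ring lra zify.
Require Import Defs.

Set Implicit Arguments.
Unset Strict Implicit.
Unset Printing Implicit Defensive.

Local Open Scope classical_set_scope.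
Local Open Scope ring_scope.

(** * Points of space and ambient isotopies *)

Section Space.
Context {R : realType}.

(** The loop has to close up in the square, whereas [g 0 = g 1] closes up only in space; so it
    cannot follow the last edge to its end and must run back over the diagram. The level 1/2 keeps
    this detour away from the crossings: all crossing heights are squeezed into [0, 1/2], and a
    level strictly between 1/2 and 1 meets the loop in just two points, one on the initial edge and
    one on the return strand. One affine map per level is therefore enough, with prescribed effect
    on two points. It must be joined to the identity through invertible maps, so its determinant has
    to be positive. In terms of the functional [dot^~ (- V)], this asks that at each level the
    return strand be farther from [V] than the initial strand, both before and after straightening.
    Since [V] is exposed, the return strand has positive distance in this sense, and the initial
    strand is kept close to [V] by letting it descend over a very short interval [0, [d]]. The norm
    enters only through this functional: a vertex of largest norm is exposed in the direction of its
    own position vector. *)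

Definition point (p : 'rV[R]_2) (z : R) : 'rV[R]_3 := row_mx p z%:M : 'rV_(2 + 1).
Definition base (v : 'rV[R]_3) : 'rV[R]_2 := lsubmx (v : 'rV_(2 + 1)).
Definition height (v : 'rV[R]_3) : R := rsubmx (v : 'rV_(2 + 1)) 0 0.

Lemma base_point p z : base (point p z) = p.
Proof. exact: row_mxKl. Qed.

Lemma height_point p z : height (point p z) = z.
Proof. by rewrite /height /point row_mxKr mxE eqxx mulr1n. Qed.

Lemma pointK v : point (base v) (height v) = v.
Proof.
by rewrite /point /base /height -mx11_scalar hsubmxK.
Qed.

Lemma point_inj p q y z : point p y = point q z -> p = q /\ y = z.
Proof.
move=> e; split; first by rewrite -(base_point p y) e base_point.
by rewrite -(height_point p y) e height_point.
Qed.

Lemma point_lshift p z (k : 'I_2) : point p z 0 (lshift 1 k) = p 0 k.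
Proof. exact: row_mxEl. Qed.

Lemma point_rshift p z (k : 'I_1) : point p z 0 (rshift 2 k) = z.
Proof.
by have := row_mxEr p (z%:M : 'M[R]_1) (0 : 'I_1) k; rewrite ord1 !mxE eqxx mulr1n.
Qed.

(* Quantifying over all filters keeps unification from unfolding the
   neighbourhood filters of spaces of matrices. *)
Lemma continuous_along (S U : topologicalType) (f : S -> U) :
  (forall (T : Type) (F : set_system T) (g : T -> S) (x : S), Filter F ->
    g @ F --> x -> f (g t) @[t --> F] --> f x) -> continuous f.
Proof. by move=> fc x; apply: (fc _ (nbhs x) id x); exact: cvg_id. Qed.

Lemma cvg_mx (T : Type) (F : set_system T) (m n : nat) (f : T -> 'M[R]_(m, n)) (l : 'M[R]_(m, n)) :
  Filter F -> (forall i j, f x i j @[x --> F] --> l i j) -> f @ F --> l.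
Proof.
move=> FF fl U [P lP PU].
apply: (@filterS _ F _ [set x | forall i j, P i j (f x i j)]).
  by move=> x Px; apply: PU.
apply: filter_forall => i; apply: filter_forall => j.
exact: fl.
Qed.

Lemma cvg_coord (T : Type) (F : set_system T) (m n : nat) (f : T -> 'M[R]_(m, n))
    (l : 'M[R]_(m, n)) i j :
  Filter F -> f @ F --> l -> f x i j @[x --> F] --> l i j.
Proof. by move=> FF fl; apply: cvg_comp fl (@coord_continuous _ m n i j l). Qed.

Lemma cvg_point (T : Type) (F : set_system T) (f : T -> 'rV[R]_2) (g : T -> R) p z :
  Filter F -> f @ F --> p -> g @ F --> z ->
  point (f x) (g x) @[x --> F] --> point p z.
Proof.
move=> FF fp gz; apply: cvg_mx => i; rewrite ord1 => j.
have [k ->|k ->] := split_ordP (j : 'I_(2 + 1)).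
- rewrite point_lshift; under eq_cvg do rewrite point_lshift.
  exact: cvg_coord.
- by rewrite point_rshift; under eq_cvg do rewrite point_rshift.
Qed.

Lemma cvg_base (T : Type) (F : set_system T) (f : T -> 'rV[R]_3) v :
  Filter F -> f @ F --> v -> base (f x) @[x --> F] --> base v.
Proof.
move=> FF fv; apply: cvg_mx => i j; rewrite mxE.
by under eq_cvg do rewrite mxE; apply: cvg_coord.
Qed.

Lemma cvg_height (T : Type) (F : set_system T) (f : T -> 'rV[R]_3) v :
  Filter F -> f @ F --> v -> height (f x) @[x --> F] --> height v.
Proof.
move=> FF fv; rewrite /height mxE.
by under eq_cvg do rewrite mxE; apply: cvg_coord.
Qed.

Lemma cvg_fstx (T U : topologicalType) (p : T * U) : q.1 @[q --> p] --> p.1.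
Proof. exact: (@cvg_fst _ _ (nbhs p.1) (nbhs p.2) _). Qed.

Lemma cvg_sndx (T U : topologicalType) (p : T * U) : q.2 @[q --> p] --> p.2.
Proof. exact: (@cvg_snd _ _ (nbhs p.1) (nbhs p.2) _). Qed.

Lemma cvg_pairx (S : Type) (F : set_system S) (T U : topologicalType)
    (f : S -> T) (g : S -> U) (x : T) (y : U) :
  Filter F -> f @ F --> x -> g @ F --> y -> (f s, g s) @[s --> F] --> (x, y).
Proof. by move=> FF fx gy; exact: (@cvg_pair _ _ _ F (nbhs x) (nbhs y)). Qed.

Definition dot {n} (u v : 'rV[R]_n) : R := \sum_i u 0 i * v 0 i.

Lemma cvg_dot n (T : Type) (F : set_system T) (f g : T -> 'rV[R]_n) u v :
  Filter F -> f @ F --> u -> g @ F --> v ->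
  dot (f x) (g x) @[x --> F] --> dot u v.
Proof.
move=> FF fu gv; rewrite /dot.
apply: cvg_big => [|i _]; last by apply: cvgM; apply: cvg_coord.
exact: (@add_continuous R^o).
Qed.

Lemma dotC n (u v : 'rV[R]_n) : dot u v = dot v u.
Proof. by apply: eq_bigr => i _; rewrite mulrC. Qed.

Lemma dotDl n (u v w : 'rV[R]_n) : dot (u + v) w = dot u w + dot v w.
Proof. by rewrite /dot -big_split; apply: eq_bigr => i _; rewrite mxE mulrDl. Qed.

Lemma dotZl n a (u w : 'rV[R]_n) : dot (a *: u) w = a * dot u w.
Proof. by rewrite /dot mulr_sumr; apply: eq_bigr => i _; rewrite mxE mulrA. Qed.

Lemma dotNl n (u w : 'rV[R]_n) : dot (- u) w = - dot u w.
Proof. by rewrite -scaleN1r dotZl mulN1r. Qed.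

Lemma dotBl n (u v w : 'rV[R]_n) : dot (u - v) w = dot u w - dot v w.
Proof. by rewrite dotDl dotNl. Qed.

Lemma dotDr n (u v w : 'rV[R]_n) : dot w (u + v) = dot w u + dot w v.
Proof. by rewrite !(dotC w) dotDl. Qed.

Lemma dotZr n a (u w : 'rV[R]_n) : dot w (a *: u) = a * dot w u.
Proof. by rewrite !(dotC w) dotZl. Qed.

Lemma dotNr n (u w : 'rV[R]_n) : dot w (- u) = - dot w u.
Proof. by rewrite !(dotC w) dotNl. Qed.

Lemma dotBr n (u v w : 'rV[R]_n) : dot w (u - v) = dot w u - dot w v.
Proof. by rewrite !(dotC w) dotBl. Qed.

Lemma dot_ge0 n (u : 'rV[R]_n) : 0 <= dot u u.
Proof. by apply: sumr_ge0 => i _; rewrite -expr2 sqr_ge0. Qed.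

Lemma dot_eq0 n (u : 'rV[R]_n) : dot u u = 0 -> u = 0.
Proof.
move/eqP; rewrite psumr_eq0 => [/allP u0|i _]; last by rewrite -expr2 sqr_ge0.
apply/rowP => i; rewrite mxE; apply/eqP.
by have := u0 i; rewrite mem_index_enum => /(_ isT); rewrite mulf_eq0 orbb.
Qed.

Lemma dot_gt0 n (u : 'rV[R]_n) : u != 0 -> 0 < dot u u.
Proof.
by move=> u0; rewrite lt_def dot_ge0 andbT; apply: contra u0 => /eqP/dot_eq0 ->.
Qed.

Lemma enorm_dot n (u : 'rV[R]_n) : enorm u = Num.sqrt (dot u u).
Proof. by congr Num.sqrt; apply: eq_bigr => i _; rewrite expr2. Qed.

End Space.

(** * Composition of ambient isotopies and two explicit families of them *)

Section Isotopy.
Context {R : realType}.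
Implicit Types K L M : set 'rV[R]_3.

Definition clamp (x : R) : R := Num.max 0 (Num.min x 1).

Lemma clamp_itv x : clamp x \in `[0, 1].
Proof.
by rewrite in_itv /= /clamp le_max lexx ge_max ler01 ge_min lexx orbT.
Qed.

Lemma clampE x : x \in `[0, 1] -> clamp x = x.
Proof.
rewrite in_itv /= => /andP[x0 x1]; rewrite /clamp.
by rewrite (elimT min_idPl x1) (elimT max_idPr x0).
Qed.

Lemma clamp_le0 x : x <= 0 -> clamp x = 0.
Proof. by move=> x0; rewrite /clamp min_l ?max_l // (le_trans x0). Qed.

Lemma clamp_ge1 x : 1 <= x -> clamp x = 1.
Proof. by move=> x1; rewrite /clamp min_r // max_r. Qed.

Lemma cvg_clamp (T : Type) (F : set_system T) (f : T -> R) l :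
  Filter F -> f @ F --> l -> clamp (f x) @[x --> F] --> clamp l.
Proof.
move=> FF fl; apply: (cvg_comp _ _ fl).
apply: (@continuous_max R R^o (fun=> 0) (fun x => Num.min x 1) l).
  exact: cvg_cst.
by apply: (@continuous_min R R^o id (fun=> 1) l); [exact: cvg_id|exact: cvg_cst].
Qed.

Lemma ambient_isotopic_trans K L M :
  ambient_isotopic K L -> ambient_isotopic L M -> ambient_isotopic K M.
Proof.
move=> [H [Hc Hh H0 HL]] [G [Gc Gh G0 GM]].
(* Clamping replaces a case distinction at s = 1/2: up to then [G] stays at time 0, where it is the
   identity, and afterwards [H] stays at time 1. No gluing of continuous maps is needed. *)
exists (fun s x => G (clamp (s *+ 2 - 1)) (H (clamp (s *+ 2)) x)).
have cvgE (E : R -> 'rV[R]_3 -> 'rV[R]_3) (T : topologicalType) (f : T -> R)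
    (g : T -> 'rV[R]_3) x :
    {within `[0, 1] `*` setT, continuous (fun p : R * 'rV[R]_3 => E p.1 p.2)} ->
    (forall y, f y \in `[0, 1]) ->
    f @ x --> f x -> g @ x --> g x -> E (f y) (g y) @[y --> x] --> E (f x) (g x).
  move=> /subspace_continuousP Ec f01 fx gx.
  have fx01 : (`[0, 1] `*` [set: 'rV[R]_3]) (f x, g x).
    by split => //=; apply: f01.
  apply: (cvg_comp (fun y => (f y, g y)) (fun p => E p.1 p.2) _ (Ec _ fx01)).
  move=> U [/= V [/= Vf Vg] VU].
  have nf : nbhs x (f @^-1` V.1) := fx _ Vf.
  have ng : nbhs x (g @^-1` V.2) := gx _ Vg.
  apply: (@filterS _ (nbhs x) _ _ _ _ (filterI nf ng)) => y [/= Vfy Vgy].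
  exact: (VU (f y, g y) (conj Vfy Vgy) (conj (f01 y) I)).
split.
- apply: continuous_subspaceT => p /=.
  have c2 : (fun q : R * 'rV[R]_3 => q.1 *+ 2) @ p --> p.1 *+ 2.
    by apply: (@cvgMn _ R^o); exact: cvg_fstx.
  apply: (cvgE G _ (fun q : R * 'rV[R]_3 => clamp (q.1 *+ 2 - 1))
    (fun q => H (clamp (q.1 *+ 2)) q.2)) => //.
  - by move=> y; apply: clamp_itv.
  - by apply: cvg_clamp; apply: (@cvgB _ R^o) c2 (cvg_cst _).
  apply: (cvgE H _ (fun q : R * 'rV[R]_3 => clamp (q.1 *+ 2)) snd) => //.
  - by move=> y; apply: clamp_itv.
  - exact: cvg_clamp.
  - exact: cvg_sndx.
- move=> s _; have [cH [H' [cH' HK KH]]] := Hh _ (clamp_itv (s *+ 2)).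
  have [cG [G' [cG' GK KG]]] := Gh _ (clamp_itv (s *+ 2 - 1)).
  split; first by move=> x; apply: continuous_comp; [exact: cH|exact: cG].
  exists (H' \o G'); split.
  + by move=> x; apply: continuous_comp; [exact: cG'|exact: cH'].
  + by move=> x /=; rewrite GK HK.
  + by move=> x /=; rewrite KH KG.
- by move=> x; rewrite mul0rn clamp_le0 ?sub0r ?lerN10 // G0 clamp_le0 // H0.
- rewrite -GM -HL -image_comp; rewrite (@clamp_ge1 (1 *+ 2)) ?mulr2n ?lerDl //.
  by rewrite -addrA subrr addr0 clamp_ge1.
Qed.

Lemma ambient_isotopic_image (H G : R -> 'rV[R]_3 -> 'rV[R]_3) K :
  continuous (fun p : R * 'rV[R]_3 => H p.1 p.2) ->
  (forall s, s \in `[0, 1] ->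
    [/\ continuous (G s), cancel (H s) (G s) & cancel (G s) (H s)]) ->
  H 0 =1 id -> ambient_isotopic K (H 1 @` K).
Proof.
move=> Hc HG H0; exists H; split => //; first exact: continuous_subspaceT.
move=> s /HG[Gc HK KH]; split; last by exists (G s).
move=> x; apply: (cvg_comp (fun y => (s, y)) (fun p => H p.1 p.2) _ (Hc (s, x))).
apply: (@cvg_pairx _ (nbhs x) _ _ (fun=> s) id).
  exact: cvg_cst.
exact: cvg_id.
Qed.

(** Keeps a determinant or a scale factor positive during the straight-line isotopies below, which
    start from the value 1. *)
Lemma segment_gt0 (s x y : R) :
  s \in `[0, 1] -> 0 < x -> 0 < y -> 0 < (1 - s) * x + s * y.
Proof.
rewrite in_itv /= => /andP[s0 s1] x0 y0; have [s_lt1|s_ge1] := ltP s 1.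
  by apply: ltr_wpDr; [rewrite mulr_ge0 // ltW|rewrite mulr_gt0 // subr_gt0].
by apply: ltr_wpDl; [rewrite mulr_ge0 ?subr_ge0 // ltW|rewrite mulr_gt0 // (lt_le_trans ltr01)].
Qed.

(* Each horizontal plane moves by an affine map whose linear part is a
   rank-one perturbation of the identity. *)
Lemma level_isotopy (C : 'rV[R]_2) (k : R -> R) (w : R -> 'rV[R]_2) K :
  continuous k -> continuous w -> (forall z, 0 < 1 + dot (w z) C) ->
  ambient_isotopic K
    [set point (base v + (dot (base v) C - k (height v)) *: w (height v))
           (height v) | v in K].
Proof.
move=> kc wc wC.
pose d s z := 1 + s * dot (w z) C.
have d_gt0 s z : s \in `[0, 1] -> 0 < d s z.
  by move=> s01; have := segment_gt0 s01 ltr01 (wC z); rewrite /d; lra.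
pose H s v := point (base v + (s * (dot (base v) C - k (height v))) *: w (height v))
  (height v).
(* [H s] multiplies [dot (base v) C - k (height v)] by [d s (height v)] and leaves the height alone;
   dividing by this factor recovers the displacement to be undone. *)
pose G s v := point (base v -
  (s * (dot (base v) C - k (height v)) / d s (height v)) *: w (height v))
  (height v).
rewrite [X in ambient_isotopic _ X](_ : _ = H 1 @` K); last first.
  by apply: eq_imagel => v _; rewrite /H mul1r.
apply: (@ambient_isotopic_image H G) => [[s v]|s s01|v].
- have hv : (fun q : R * 'rV[R]_3 => height q.2) @ (s, v) --> height v.
    by apply: cvg_height; exact: cvg_sndx.
  have bv : (fun q : R * 'rV[R]_3 => base q.2) @ (s, v) --> base v.
    by apply: cvg_base; exact: cvg_sndx.
  apply: cvg_point; last exact: hv.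
  apply: cvgD; first exact: bv.
  apply: cvgZ; last exact: (cvg_comp _ _ hv (wc _)).
  apply: cvgM; first exact: cvg_fstx.
  apply: (@cvgB _ R^o); last exact: (cvg_comp _ _ hv (kc _)).
  by apply: cvg_dot; [exact: bv|exact: cvg_cst].
- split => [|v|v].
  + apply: continuous_along => T F f v FF fv.
    have hv := cvg_height FF fv; have bv := cvg_base FF fv.
    have wv : w (height (f x)) @[x --> F] --> w (height v) := cvg_comp _ _ hv (wc _).
    apply: cvg_point; last exact: hv.
    apply: cvgB; first exact: bv.
    apply: cvgZ; last exact: wv.
    apply: cvgM; last first.
      apply: cvgV; first by rewrite gt_eqF ?d_gt0.
      apply: (@cvgD _ R^o); first exact: cvg_cst.
      apply: cvgM; first exact: cvg_cst.
      by apply: cvg_dot => //; exact: cvg_cst.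
    apply: cvgM; first exact: cvg_cst.
    apply: (@cvgB _ R^o); first by apply: cvg_dot => //; exact: cvg_cst.
    exact: (cvg_comp _ _ hv (kc _)).
  + rewrite /G /H !base_point !height_point -[RHS]pointK; congr point.
    rewrite dotDl dotZl -addrA -scalerBl [X in X *: _](_ : _ = 0) ?scale0r ?addr0 //.
    have := gt_eqF (d_gt0 s (height v) s01); rewrite /d => /negbT d0.
    by field.
  + rewrite /G /H !base_point !height_point -[RHS]pointK; congr point.
    rewrite dotBl dotZl -addrA -scaleNr -scalerDl.
    rewrite [X in X *: _](_ : _ = 0) ?scale0r ?addr0 //.
    have := gt_eqF (d_gt0 s (height v) s01); rewrite /d => /negbT d0.
    by field.
- by rewrite /H mul0r scale0r addr0 pointK.
Qed.

(** Serves two purposes: with [m = 1] it changes the heights over a fixed plane curve, with [W = 0]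
    and [e = 1] it rescales the plane. *)
Lemma vertical_isotopy (m e : R) (W : 'rV[R]_2 -> R) K :
  0 < m -> 0 < e -> continuous W ->
  ambient_isotopic K
    [set point (m *: base v) (e * height v + W (base v)) | v in K].
Proof.
move=> m0 e0 Wc.
pose l (x s : R) := 1 + s * (x - 1).
have l_gt0 x s : s \in `[0, 1] -> 0 < x -> 0 < l x s.
  by move=> s01 x0; have := segment_gt0 s01 ltr01 x0; rewrite /l; lra.
pose H s v := point (l m s *: base v) (l e s * height v + s * W (base v)).
pose G s v := point ((l m s)^-1 *: base v)
  ((l e s)^-1 * (height v - s * W ((l m s)^-1 *: base v))).
rewrite [X in ambient_isotopic _ X](_ : _ = H 1 @` K); last first.
  by apply: eq_imagel => v _; rewrite /H /l !mul1r ![1 + _]addrC !subrK.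
apply: (@ambient_isotopic_image H G) => [[s v]|s s01|v].
- have hv : (fun q : R * 'rV[R]_3 => height q.2) @ (s, v) --> height v.
    by apply: cvg_height; exact: cvg_sndx.
  have bv : (fun q : R * 'rV[R]_3 => base q.2) @ (s, v) --> base v.
    by apply: cvg_base; exact: cvg_sndx.
  have lv x : (fun q : R * 'rV[R]_3 => l x q.1) @ (s, v) --> l x s.
    apply: (@cvgD _ R^o); first exact: cvg_cst.
    by apply: cvgM; [exact: cvg_fstx|exact: cvg_cst].
  apply: cvg_point; first exact: cvgZ (lv m) bv.
  apply: (@cvgD _ R^o); first exact: cvgM (lv e) hv.
  exact: cvgM (@cvg_fstx _ _ (s, v)) (cvg_comp _ _ bv (Wc _)).
- have lm0 := negbT (gt_eqF (l_gt0 m s s01 m0)).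
  have le0 := negbT (gt_eqF (l_gt0 e s s01 e0)).
  split => [|v|v].
  + apply: continuous_along => T F f v FF fv; have hv := cvg_height FF fv.
    have bv : (l m s)^-1 *: base (f x) @[x --> F] --> (l m s)^-1 *: base v.
      by apply: cvgZ; [exact: cvg_cst|exact: cvg_base].
    apply: cvg_point => //; apply: cvgM; first exact: cvg_cst.
    apply: (@cvgB _ R^o) => //; apply: cvgM; first exact: cvg_cst.
    exact: (cvg_comp _ _ bv (Wc _)).
  + rewrite /G /H !base_point !height_point -[RHS]pointK scalerA mulVf //.
    by rewrite scale1r addrK mulKf.
  + rewrite /G /H !base_point !height_point -[RHS]pointK scalerA mulfV //.
    by rewrite scale1r mulVKf // subrK.
- by rewrite /H /l !mul0r !addr0 !mul1r scale1r pointK.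
Qed.

End Isotopy.

(** * Piecewise linear functions *)

Section Breakpoints.
Context {R : realType}.
Implicit Types (a : nat -> R) (n : nat).

Definition increasing_upto n a := forall i, (i < n)%N -> a i < a i.+1.

Lemma increasing_upto_le n a i j :
  increasing_upto n a -> (i <= j <= n)%N -> a i <= a j.
Proof.
move=> an /andP[]; elim: j => [|j IH]; first by rewrite leqn0 => /eqP ->.
rewrite leq_eqVlt => /orP[/eqP -> //|]; rewrite ltnS => ij jn.
by apply: le_trans (IH ij (ltnW jn)) (ltW (an _ jn)).
Qed.

Lemma increasing_upto_lt n a i j :
  increasing_upto n a -> (i < j <= n)%N -> a i < a j.
Proof.
move=> an /andP[ij jn]; apply: lt_le_trans (an i _) _; first exact: leq_trans jn.
by apply: increasing_upto_le an _; rewrite ij jn.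
Qed.

Lemma locate_piece n a x : (0 < n)%N -> a 0%N <= x <= a n ->
  exists2 k, (k < n)%N & a k <= x <= a k.+1.
Proof.
elim: n => // n IH _ /andP[a0 an].
have [xn|xn] := leP (a n) x; first by exists n; rewrite // xn.
have [n0|n0] := posnP n; first by move: xn; rewrite n0 ltNge a0.
have [|k kn ak] := IH n0; first by rewrite a0 ltW.
by exists k => //; apply: ltnW.
Qed.

Lemma itv_partition_nthS (s : seq R) : itv_partition 0 1 s ->
  increasing_upto (size s) (nth 0 (0 :: s)).
Proof. by move=> [/(pathP 0) + _] i si; apply. Qed.

Lemma itv_partition_last (s : seq R) : itv_partition 0 1 s ->
  nth 0 (0 :: s) (size s) = 1.
Proof.
by move=> [_ /eqP]; case: s => [/= ->|x s <-] //; rewrite (last_nth 0).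
Qed.

Lemma itv_partition_size_gt0 (s : seq R) : itv_partition 0 1 s -> (0 < size s)%N.
Proof. by case: s => // /itv_partition_nil/esym/eqP; rewrite oner_eq0. Qed.

Lemma itv_partition_itv (s : seq R) i : itv_partition 0 1 s -> (i <= size s)%N ->
  0 <= nth 0 (0 :: s) i <= 1.
Proof.
move=> sp si; have sn := itv_partition_nthS sp; apply/andP; split.
  exact: (increasing_upto_le (i := 0%N) sn si).
by rewrite -(itv_partition_last sp); apply: increasing_upto_le sn _; rewrite si leqnn.
Qed.

Lemma affine_along_pieces m (s : seq R) (c : R -> 'rV[R]_m) : affine_along s c ->
  exists u v : nat -> 'rV[R]_m, forall i t, (i < size s)%N ->
    nth 0 (0 :: s) i <= t <= nth 0 (0 :: s) i.+1 -> c t = u i + t *: v i.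
Proof.
move=> [_ pc].
have /choice[uv uvP] i : exists uv : 'rV[R]_m * 'rV[R]_m, (i < size s)%N ->
    forall t, nth 0 (0 :: s) i <= t <= nth 0 (0 :: s) i.+1 -> c t = uv.1 + t *: uv.2.
  have [si|si] := ltnP i (size s); last by exists (0, 0).
  have [u [v uvi]] := pc i si.
  by exists (u, v) => _ t ti; apply: uvi; rewrite in_itv.
by exists (fun i => (uv i).1), (fun i => (uv i).2) => i t si; apply: uvP.
Qed.

End Breakpoints.

Section PiecewiseLinear.
Context {R : realType}.
Implicit Types (a : nat -> R) (n : nat).

(* The piecewise linear function with value 0 at 0 and slope e i on the i-th of
   n pieces, as a sum of hinges, so that it is defined and continuous on the
   whole line and the creases are the hinges with e i <> e i.-1. *)
Definition pl {V : lmodType R} a (e : nat -> V) n x : V :=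
  x *: e 0%N + \sum_(1 <= i < n) Num.max (x - a i) 0 *: (e i - e i.-1).

Section Module.
Context {V : lmodType R}.
Implicit Types e : nat -> V.

Lemma pl_lower a e n k x : increasing_upto n a -> (k < n)%N -> a k <= x ->
  (forall i, (k < i < n)%N -> x <= a i) ->
  pl a e n x = x *: e 0%N + \sum_(1 <= i < k.+1) (x - a i) *: (e i - e i.-1).
Proof.
move=> an kn ax xa; congr (_ + _).
rewrite (@big_cat_nat _ _ _ k.+1) //=.
rewrite [X in _ + X]big_nat_cond [X in _ + X]big1 ?addr0; last first.
  by move=> i; rewrite andbT => ki; rewrite max_r ?scale0r // subr_le0 xa.
apply: eq_big_nat => i /andP[_ ik]; rewrite max_l // subr_ge0.
by apply: le_trans _ ax; apply: increasing_upto_le an _; rewrite -ltnS ik ltnW.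
Qed.

(** The upper bound on [x] is imposed only at hinges, so that for the last piece it is vacuous: [pl]
    continues affinely on the whole ray, as the hinge argument for arc length requires. *)
Lemma pl_affine a e n k x : increasing_upto n a -> (k < n)%N -> a k <= x ->
  (forall i, (k < i < n)%N -> x <= a i) ->
  pl a e n x = pl a e n (a k) + (x - a k) *: e k.
Proof.
move=> an kn ax xa; rewrite (pl_lower _ an kn ax xa) (@pl_lower _ _ _ k (a k)) //; last first.
  by move=> i /andP[ki ni]; apply: increasing_upto_le an _; rewrite (ltnW ki) ltnW.
have -> : e k = e 0%N + \sum_(1 <= i < k.+1) (e i - e i.-1).
  rewrite big_add1 /= telescope_sumr //; first by rewrite addrC subrK.
rewrite scalerDr scaler_sumr -[RHS]addrA [X in _ = _ + X]addrCA -big_split /= addrA.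
rewrite -scalerDl [a k + _]addrC subrK; congr (_ + _); apply: eq_bigr => i _.
by rewrite -scalerDl; congr (_ *: _); ring.
Qed.

Lemma pl_piece a e n k x : increasing_upto n a -> (k < n)%N -> a k <= x <= a k.+1 ->
  pl a e n x = pl a e n (a k) + (x - a k) *: e k.
Proof.
move=> an kn /andP[ax xa]; apply: pl_affine => // i /andP[ki ni].
by apply: le_trans xa _; apply: increasing_upto_le an _; rewrite ki ltnW.
Qed.

Lemma pl_ray a e n x : increasing_upto n.+1 a -> a n <= x ->
  pl a e n.+1 x = pl a e n.+1 (a n) + (x - a n) *: e n.
Proof.
move=> an ax; apply: pl_affine => // i.
by rewrite ltnS => /andP[ni /(leq_trans ni)]; rewrite ltnn.
Qed.

Lemma pl0 a e n : a 0%N = 0 -> increasing_upto n a -> pl a e n 0 = 0.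
Proof.
move=> a0 an; rewrite /pl scale0r add0r big_nat_cond big1 // => i.
rewrite andbT => /andP[i0 ni]; rewrite max_r ?scale0r // sub0r oppr_le0 -a0.
by apply: increasing_upto_le an _; rewrite leq0n ltnW.
Qed.

Lemma pl_knot a e n k : a 0%N = 0 -> increasing_upto n a -> (k <= n)%N ->
  pl a e n (a k) = \sum_(i < k) (a i.+1 - a i) *: e i.
Proof.
move=> a0 an; elim: k => [_|k IH kn]; first by rewrite big_ord0 a0 pl0.
rewrite big_ord_recr -IH 1?ltnW //=; apply: pl_piece => //.
by rewrite lexx ltW // an.
Qed.

Definition interp_slope a (y : nat -> V) i := (a i.+1 - a i)^-1 *: (y i.+1 - y i).

Lemma interp_knot a (y : nat -> V) n k :
  a 0%N = 0 -> increasing_upto n a -> (k <= n)%N ->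
  y 0%N + pl a (interp_slope a y) n (a k) = y k.
Proof.
move=> a0 an kn; rewrite pl_knot //.
under eq_bigr => i _.
  rewrite scalerA mulfV ?scale1r; last first.
    by rewrite subr_eq0 gt_eqF // an // (leq_trans (ltn_ord i)).
  over.
by rewrite -(big_mkord xpredT (fun i => y i.+1 - y i)) telescope_sumr // addrC subrK.
Qed.

End Module.

Lemma cvg_pl {V : normedModType R} a (e : nat -> V) n (T : Type) (F : set_system T)
    (f : T -> R) x :
  Filter F -> f @ F --> x -> pl a e n (f t) @[t --> F] --> pl a e n x.
Proof.
move=> FF fx; apply: cvgD; first by apply: cvgZ => //; exact: cvg_cst.
apply: cvg_big => [|i _]; first exact: (@add_continuous V).
apply: cvgZ; last exact: cvg_cst.
have fa : (fun t => f t - a i) @ F --> x - a i.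
  by apply: (@cvgB _ R^o) => //; exact: cvg_cst.
apply: (cvg_comp _ (fun z => Num.max z 0) fa).
by apply: (@continuous_max R R^o id (fun=> 0)); [exact: cvg_id|exact: cvg_cst].
Qed.

Lemma continuous_pl {V : normedModType R} a (e : nat -> V) n : continuous (pl a e n).
Proof. by move=> x; apply: (@cvg_pl _ _ _ _ _ _ id); exact: cvg_id. Qed.

End PiecewiseLinear.

(** * Foldings with vertical creases *)

Section ArcLength.
Context {R : realType}.

Lemma cauchy_schwarz n (u v : 'rV[R]_n) : dot u v ^+ 2 <= dot u u * dot v v.
Proof.
have [->|v0] := eqVneq v 0.
  by rewrite -[0](scale0r 0) !dotZr !mul0r expr0n mulr0.
(* This square expands to [dot v v] times the difference of the two sides. *)
have := dot_ge0 (dot v v *: u - dot u v *: v); have := dot_gt0 v0.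
rewrite dotBl !dotBr !dotZl !dotZr (dotC v u); nra.
Qed.

Lemma enorm_triangle n (u v : 'rV[R]_n) : enorm (u + v) <= enorm u + enorm v.
Proof.
rewrite !enorm_dot -(@ler_pXn2r _ 2) ?nnegrE ?addr_ge0 ?sqrtr_ge0 //.
rewrite sqrrD !sqr_sqrtr ?dot_ge0 // dotDl !dotDr (dotC v u).
suff : dot u v <= Num.sqrt (dot u u) * Num.sqrt (dot v v) by rewrite mulr2n; lra.
apply: le_trans (ler_norm _) _; rewrite -sqrtrM ?dot_ge0 // -sqrtr_sqr.
by rewrite ler_wsqrtr // cauchy_schwarz.
Qed.

(** The sums of [arc_length] in recursive form, fit for induction on a partition with a moving
    starting time. *)
Definition chain_length n (p : R -> 'rV[R]_n) := fix loop (t : R) s :=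
  if s is u :: s' then enorm (p u - p t) + loop u s' else 0.

Lemma chain_lengthE n (p : R -> 'rV[R]_n) t s :
  \sum_(i < size s) enorm (p (nth 0 s i) - p (nth 0 (t :: s) i)) =
  chain_length p t s.
Proof.
elim: s t => [|u s IH] t /=; first by rewrite big_ord0.
rewrite big_ord_recl /= -IH; congr (_ + _); apply: eq_bigr => i _.
Qed.

Section Hinge.
Variables (A B : 'rV[R]_2 -> 'rV[R]_3) (c : R).
Hypothesis AB : forall u v : 'rV[R]_2,
  (u 0 0 <= c /\ v 0 0 <= c) \/ (c <= u 0 0 /\ c <= v 0 0) ->
  enorm (A u - A v) = enorm (B u - B v).

(* Between two times at which the path lies strictly on opposite sides of the
   crease, insert a time at which it crosses the crease. *)
Lemma hinge_chain (p : R -> 'rV[R]_2) t s : {within `[0, 1], continuous p} ->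
  0 <= t -> path <%R t s -> last t s <= 1 ->
  exists s', [/\ path <%R t s', last t s' = last t s &
    chain_length (A \o p) t s <= chain_length (B \o p) t s'].
Proof.
move=> pc; elim: s t => [|u s IH] t t0 /=; first by exists [::].
move=> /andP[tu us] s1; have [|s' [us' lastE le_s]] := IH u _ us s1.
  exact: le_trans t0 (ltW tu).
have [same|] := pselect ((p u 0 0 <= c /\ p t 0 0 <= c) \/ (c <= p u 0 0 /\ c <= p t 0 0)).
  by exists (u :: s') => /=; rewrite tu us'; split => //; rewrite (AB same) lerD2l.
move=> diff.
have u1 : u <= 1.
  apply: le_trans s1; elim: (s) u us {tu IH us' lastE le_s diff} => //= w r IHr u.
  by move=> /andP[uw /IHr]; apply: le_trans; apply: ltW.
have pc' : {within `[t, u], continuous (fun x => p x 0 0)}.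
  apply: (@continuous_subspaceW _ _ `[t, u] `[0, 1]).
    by move=> x /=; rewrite !in_itv /= => /andP[tx xu]; rewrite (le_trans t0 tx) (le_trans xu).
  by move=> x; apply: cvg_coord (pc x).
have [|w] := @IVT _ (fun x => p x 0 0) t u c (ltW tu) pc'.
  rewrite ge_min le_max; apply/andP; split; apply/orP.
    have [?|ct] := leP (p t 0 0) c; first by left.
    have [?|cu] := leP (p u 0 0) c; first by right.
    by case: diff; right; split; apply: ltW.
  have [?|ct] := leP c (p t 0 0); first by left.
  have [?|cu] := leP c (p u 0 0); first by right.
  by case: diff; left; split; apply: ltW.
rewrite in_itv /= => /andP[tw wu] pw.
have side v : (p v 0 0 <= c /\ p w 0 0 <= c) \/ (c <= p v 0 0 /\ c <= p w 0 0).
  by rewrite pw lexx; have [?|/ltW ?] := leP (p v 0 0) c; [left|right].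
have wt : w != t.
  by apply/eqP => wt; apply: diff; rewrite -wt; apply: side.
have wu' : w != u.
  apply/eqP => wu'; apply: diff; rewrite -wu'.
  by have [[? ?]|[? ?]] := side t; [left|right].
exists (w :: u :: s') => /=; rewrite us' !lt_def wt tw eq_sym wu' wu; split => //.
rewrite addrA; apply: lerD => //.
have -> : A (p u) - A (p t) = (A (p u) - A (p w)) + (A (p w) - A (p t)).
  by rewrite addrA subrK.
apply: le_trans (enorm_triangle _ _) _; rewrite addrC.
rewrite (AB (side u)) (AB (_ : _ \/ _)) //.
by have [[? ?]|[? ?]] := side t; [left|right].
Qed.

Lemma hinge_arc_length_le (p : R -> 'rV[R]_2) : {within `[0, 1], continuous p} ->
  (arc_length (A \o p) <= arc_length (B \o p))%E.
Proof.
move=> pc; apply: ge_ereal_sup => _ [s [s_path /eqP s_last] <-].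
rewrite chain_lengthE.
have [||s' [s'_path s'_last le_s]] := @hinge_chain p 0 s pc _ s_path; rewrite ?s_last //.
apply: le_trans (_ : ((chain_length (B \o p) 0 s')%:E <= _)%E); first by rewrite lee_fin.
apply: ereal_sup_ubound; exists s'; last by rewrite chain_lengthE.
by split => //; rewrite s'_last s_last.
Qed.

End Hinge.

(** The hypothesis is symmetric in [A] and [B], so the inequality obtained by refining partitions at
    crossings of the line applies in both directions. *)
Lemma hinge_arc_length (A B : 'rV[R]_2 -> 'rV[R]_3) c (p : R -> 'rV[R]_2) :
  (forall u v : 'rV[R]_2,
    (u 0 0 <= c /\ v 0 0 <= c) \/ (c <= u 0 0 /\ c <= v 0 0) ->
    enorm (A u - A v) = enorm (B u - B v)) ->
  {within `[0, 1], continuous p} ->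
  arc_length (A \o p) = arc_length (B \o p).
Proof.
move=> AB pc; apply/eqP; rewrite eq_le; apply/andP; split.
  exact: hinge_arc_length_le AB _ pc.
by apply: (@hinge_arc_length_le _ _ c) => // u v /AB.
Qed.

End ArcLength.

(** * The cylinder over a polygonal curve preserves arc length *)

Section Fold.
Context {R : realType}.
Variables (a : nat -> R) (e : nat -> 'rV[R]_2) (V : 'rV[R]_2).

Definition fold n (v : 'rV[R]_2) : 'rV[R]_3 := point (V + pl a e n (v 0 0)) (v 0 1).

Lemma dot_point (p q : 'rV[R]_2) y z : dot (point p y) (point q z) = dot p q + y * z.
Proof.
rewrite /dot big_ord_recr /=; congr (_ + _).
  apply: eq_bigr => i _; rewrite (_ : widen_ord _ i = lshift 1 i) ?point_lshift //.
  exact: val_inj.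
rewrite (_ : ord_max = rshift 2 ord0) ?point_rshift //.
exact: val_inj.
Qed.

Lemma pointB (p q : 'rV[R]_2) y z : point p y - point q z = point (p - q) (y - z).
Proof.
apply/rowP => j; rewrite [LHS]mxE [X in _ + X]mxE.
have [k ->|k ->] := split_ordP (j : 'I_(2 + 1)).
  by rewrite !point_lshift !mxE.
by rewrite !point_rshift.
Qed.

Lemma pointD (p q : 'rV[R]_2) y z : point p y + point q z = point (p + q) (y + z).
Proof.
apply/rowP => j; rewrite [LHS]mxE.
have [k ->|k ->] := split_ordP (j : 'I_(2 + 1)).
  by rewrite !point_lshift !mxE.
by rewrite !point_rshift.
Qed.

Lemma pointZ k (p : 'rV[R]_2) y : point (k *: p) (k * y) = k *: point p y.
Proof.
apply/rowP => j; rewrite [RHS]mxE.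
have [i ->|i ->] := split_ordP (j : 'I_(2 + 1)).
  by rewrite !point_lshift !mxE.
by rewrite !point_rshift.
Qed.

(** Pythagoras: on a common affine piece with unit slope, the horizontal displacement has the length
    of the difference of abscissas. *)
Lemma fold_dist m (X : R) (d : 'rV[R]_2) (u v : 'rV[R]_2) :
  dot d d = 1 ->
  (forall w : 'rV[R]_2, w = u \/ w = v -> pl a e m (w 0 0) = pl a e m X + (w 0 0 - X) *: d) ->
  enorm (fold m u - fold m v) = enorm (u - v).
Proof.
move=> d1 fuv; rewrite !enorm_dot pointB dot_point; congr Num.sqrt.
rewrite !fuv; [|by right|by left].
rewrite [V + (_ + _)]addrA [V + (_ + _ *: _)]addrA opprD addrACA subrr add0r -scalerBl.
rewrite dotZl dotZr d1 /dot big_ord_recl big_ord1 !mxE.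
rewrite (_ : lift ord0 ord0 = 1) //; first by ring.
exact: val_inj.
Qed.

(** One hinge at a time. [fold 1] is an isometry of the plane; [fold m.+1] and [fold m.+2] coincide
    to the left of [a m.+1], and both are isometric to its right, where each follows its last
    ray. *)
Lemma fold_arc_length n (p : R -> 'rV[R]_2) : a 0%N = 0 -> increasing_upto n a -> (0 < n)%N ->
  (forall i, (i < n)%N -> dot (e i) (e i) = 1) ->
  {within `[0, 1], continuous p} -> arc_length p = arc_length (fold n \o p).
Proof.
move=> a0 an n0 e1 pc.
suff H m : (m < n)%N -> arc_length p = arc_length (fold m.+1 \o p).
  by rewrite -(prednK n0); apply: H; rewrite prednK.
elim: m => [|m IH] mn.
  congr ereal_sup; apply: eq_imagel => s _; congr EFin; apply: eq_bigr => i _ /=.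
  apply/esym/(@fold_dist 1 0 (e 0%N)); first exact: e1.
  move=> w _; rewrite pl0 ?a0 //; last by case=> // _; apply: an.
  by rewrite add0r subr0 /pl big_geq // addr0.
suff AB (u v : 'rV[R]_2) : (u 0 0 <= a m.+1 /\ v 0 0 <= a m.+1) \/
    (a m.+1 <= u 0 0 /\ a m.+1 <= v 0 0) ->
    enorm (fold m.+1 u - fold m.+1 v) = enorm (fold m.+2 u - fold m.+2 v).
  exact (etrans (IH (ltnW mn)) (hinge_arc_length AB pc)).
have anm : increasing_upto m.+2 a by move=> i im; apply: an; apply: leq_trans im mn.
have anm' : increasing_upto m.+1 a by move=> i im; apply: anm; apply: ltnW.
have plS x : pl a e m.+2 x = pl a e m.+1 x + Num.max (x - a m.+1) 0 *: (e m.+1 - e m).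
  by rewrite /pl big_nat_recr //= addrA.
case=> [[ua va]|[ua va]].
  by rewrite /fold !plS ![Num.max _ 0]max_r ?subr_le0 // !scale0r !addr0.
rewrite (@fold_dist m.+1 (a m) (e m)); last 2 first.
- by apply: e1; apply: ltnW.
- move=> w wuv; apply: pl_ray => //; apply: le_trans (ltW (anm' m _)) _ => //.
  by case: wuv => ->.
rewrite (@fold_dist m.+2 (a m.+1) (e m.+1)) //; first exact: e1.
by move=> w wuv; apply: pl_ray => //; case: wuv => ->.
Qed.

End Fold.

(** * Vertical strips of the square are polygons *)

Section Rectangle.
Context {R : realType}.

Definition vec (x y : R) : 'rV[R]_2 := \row_j (if j == 0 then x else y).

Lemma vec0 x y : vec x y 0 0 = x. Proof. by rewrite mxE eqxx. Qed.
Lemma vec1 x y : vec x y 0 1 = y. Proof. by rewrite mxE. Qed.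

Lemma vec_coord (v : 'rV[R]_2) : v = vec (v 0 0) (v 0 1).
Proof.
apply/rowP => j; rewrite mxE; case: ifP => [/eqP -> //|j0].
by congr (v 0 _); apply: val_inj; case: j j0 => [[|[|]]].
Qed.

Lemma vec_eq (u v : 'rV[R]_2) : u 0 0 = v 0 0 -> u 0 1 = v 0 1 -> u = v.
Proof. by move=> e0 e1; rewrite [u]vec_coord [v]vec_coord e0 e1. Qed.

Lemma cvg_vec (T : Type) (F : set_system T) (f g : T -> R) x y :
  Filter F -> f @ F --> x -> g @ F --> y -> vec (f t) (g t) @[t --> F] --> vec x y.
Proof.
move=> FF fx gy; apply: cvg_mx => i j; rewrite mxE.
by under eq_cvg do rewrite mxE; case: ifP.
Qed.

Lemma nbhs_coord n (v : 'rV[R]_n) i x y : v 0 i \in `]x, y[ ->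
  nbhs v [set u : 'rV[R]_n | u 0 i \in `]x, y[].
Proof.
move=> vi; have : nbhs (v 0 i) [set t | t \in `]x, y[] by exact: near_in_itvoo.
exact: (@coord_continuous R _ _ 0 i v).
Qed.

Variables (x1 x2 : R).
Hypothesis x12 : x1 < x2.

Definition rectangle : set 'rV[R]_2 :=
  [set v | x1 <= v 0 0 <= x2 /\ 0 <= v 0 1 <= 1].

(** Trapezoidal functions, shifted against each other by a quarter: the boundary is run through
    counterclockwise from the lower left corner, one side per quarter of the time. *)
Let A (t : R) := clamp (4 * t) - clamp (4 * t - 2).
Let B (t : R) := clamp (4 * t - 1) - clamp (4 * t - 3).
Let c t := vec (x1 + (x2 - x1) * A t) (B t).

Let quarter t : 0 <= t <= 1 ->
  [\/ t <= 1/4 /\ (A t = 4 * t /\ B t = 0), 1/4 <= t <= 1/2 /\ (A t = 1 /\ B t = 4 * t - 1),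
      1/2 <= t <= 3/4 /\ (A t = 3 - 4 * t /\ B t = 1) |
      3/4 <= t /\ (A t = 0 /\ B t = 4 - 4 * t)].
Proof.
move=> /andP[t0 t1]; rewrite /A /B.
have [h1|h1] := leP t (1/4).
  constructor 1; split => //; rewrite (@clamp_le0 _ (4 * t - 2)) ?(@clamp_le0 _ (4 * t - 1))
    ?(@clamp_le0 _ (4 * t - 3)); try lra.
  by rewrite clampE ?in_itv /=; lra.
have [h2|h2] := leP t (1/2).
  constructor 2; split; first lra.
  rewrite (@clamp_le0 _ (4 * t - 2)) ?(@clamp_ge1 _ (4 * t)) ?(@clamp_le0 _ (4 * t - 3)); try lra.
  by rewrite clampE ?in_itv /=; lra.
have [h3|h3] := leP t (3/4).
  constructor 3; split; first lra.
  rewrite (@clamp_ge1 _ (4 * t)) ?(@clamp_ge1 _ (4 * t - 1)) ?(@clamp_le0 _ (4 * t - 3)); try lra.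
  by rewrite clampE ?in_itv /=; lra.
constructor 4; split; first lra.
rewrite (@clamp_ge1 _ (4 * t)) ?(@clamp_ge1 _ (4 * t - 1)) ?(@clamp_ge1 _ (4 * t - 2)); try lra.
by rewrite clampE ?in_itv /=; lra.
Qed.

Let c_continuous : continuous c.
Proof.
apply: continuous_along => T F f t FF ft.
have f4 k : clamp (4 * f s - k) @[s --> F] --> clamp (4 * t - k).
  apply: cvg_clamp; apply: (@cvgB _ R^o); last exact: cvg_cst.
  by apply: cvgM => //; exact: cvg_cst.
have f0 : clamp (4 * f s) @[s --> F] --> clamp (4 * t).
  by apply: cvg_clamp; apply: cvgM => //; exact: cvg_cst.
apply: cvg_vec; last exact: (@cvgB _ R^o) (f4 1) (f4 3).
apply: (@cvgD _ R^o); first exact: cvg_cst.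
by apply: cvgM; [exact: cvg_cst|exact: (@cvgB _ R^o) f0 (f4 2)].
Qed.

Let c_pl : pl_simple_loop c.
Proof.
have itv01 t : t \in `[0, 1[ -> 0 <= t <= 1.
  by rewrite in_itv /= => /andP[-> /ltW ->].
split; first split.
- exact: continuous_subspaceT.
- have A0 : A 0 = 0 /\ B 0 = 0.
    by case: (@quarter 0) => [|[? [-> ->]]|[? [-> ->]]|[? [-> ->]]|[? [-> ->]]]; lra.
  have A1 : A 1 = 0 /\ B 1 = 0.
    by case: (@quarter 1) => [|[? [-> ->]]|[? [-> ->]]|[? [-> ->]]|[? [-> ->]]]; lra.
  by rewrite /c (proj1 A0) (proj2 A0) (proj1 A1) (proj2 A1).
- move=> t u /[dup] t01 /itv01/quarter tq /[dup] u01 /itv01/quarter uq ctu.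
  have eA : A t = A u.
    have := congr1 (fun v : 'rV[R]_2 => v 0 0) ctu; rewrite !vec0 => /addrI.
    by apply: mulfI; rewrite subr_eq0 gt_eqF.
  have eB : B t = B u by have := congr1 (fun v : 'rV[R]_2 => v 0 1) ctu; rewrite !vec1.
  move: t01 u01; rewrite !in_itv /= => t01 u01.
  by case: tq => -[? [? ?]]; case: uq => -[? [? ?]]; lra.
exists [:: 1/4; 1/2; 3/4; 1]; split.
  by split => //=; rewrite !andbT; apply/and4P; split; lra.
(* For each side, the constant term and slope of [A], followed by those of [B]. *)
pose pu : seq (R * R * R * R) :=
  [:: (0, 4, 0, 0); (1, 0, -1, 4); (3, -4, 1, 0); (0, 0, 4, -4)].
move=> i i4; exists (vec (x1 + (x2 - x1) * (nth (0,0,0,0) pu i).1.1.1) (nth (0,0,0,0) pu i).1.2).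
exists (vec ((x2 - x1) * (nth (0,0,0,0) pu i).1.1.2) (nth (0,0,0,0) pu i).2) => t ti.
suff [At Bt] : A t = (nth (0, 0, 0, 0) pu i).1.1.1 + t * (nth (0, 0, 0, 0) pu i).1.1.2 /\
    B t = (nth (0, 0, 0, 0) pu i).1.2 + t * (nth (0, 0, 0, 0) pu i).2.
  by rewrite /c At Bt; apply: vec_eq; rewrite ?vec0 ?vec1 !mxE /=; ring.
have t01 : 0 <= t <= 1.
  by move: ti; rewrite in_itv; case: i i4 => [|[|[|[|//]]]] _ /=; lra.
by move: ti; rewrite in_itv; case: i i4 => [|[|[|[|//]]]] _ /= ti;
  case: (quarter t01) => -[? [-> ->]]; split; lra.
Qed.

Lemma interior_rectangle :
  interior rectangle = [set v | x1 < v 0 0 < x2 /\ 0 < v 0 1 < 1].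
Proof.
apply/seteqP; split => v.
  move=> /nbhs_ballP[r /= r0 vr].
  have rv x y : `|x| < r -> `|y| < r -> rectangle (v + vec x y).
    move=> xr yr; apply: vr; split => // i j; rewrite ord1 /ball /= !mxE.
    by rewrite opprD addrA subrr sub0r normrN; case: ifP.
  have r2 : `|r / 2| < r by rewrite ger0_norm; lra.
  have r2N : `|- (r / 2)| < r by rewrite normrN.
  (* Half a radius up and down along the diagonal makes all four inequalities strict. *)
  have [] := rv _ _ r2 r2; have [] := rv _ _ r2N r2N.
  by rewrite !mxE /=; lra.
move=> [vx vy]; have nx : nbhs v [set u : 'rV[R]_2 | u 0 0 \in `]x1, x2[].
  by apply: nbhs_coord; rewrite in_itv.
have ny : nbhs v [set u : 'rV[R]_2 | u 0 1 \in `]0, 1[].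
  by apply: nbhs_coord; rewrite in_itv.
apply: (@filterS _ (nbhs v) _ _ _ _ (filterI nx ny)) => u /=.
by rewrite !in_itv /rectangle /=; lra.
Qed.

Lemma rectangle_polygon : polygon rectangle.
Proof.
have Rc : compact rectangle.
  rewrite (_ : rectangle = [set v : 'rV[R]_2 | forall i,
    (if i == 0 then `[x1, x2]%classic else `[0, 1]%classic) (v ord0 i)]).
    apply: (@rV_compact R 2
      (fun i => if i == 0 then `[x1, x2]%classic else `[0, 1]%classic)).
    by move=> i; case: ifP => _; apply: segment_compact.
  apply/seteqP; split => v /=.
    move=> [vx vy] i; case: ifP => [/eqP ->|i0]; first by rewrite /= in_itv.
    rewrite (_ : i = 1) /= ?in_itv //.
    by apply: val_inj; case: i i0 => [[|[|]]].
  by move=> vi; split; [have := vi 0|have := vi 1]; rewrite /= in_itv.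
split => //.
  rewrite interior_rectangle; exists (vec ((x1 + x2) / 2) (1 / 2)).
  by rewrite /= vec0 vec1; have := x12; split; lra.
exists c => //; rewrite -(proj1 (closure_id _)); last first.
  by apply: compact_closed => //; apply: norm_hausdorff.
rewrite interior_rectangle; apply/seteqP; split => v /=.
  move=> [[vx vy] vb]; set y := v 0 1 in vy vb.
  have x12' := x12; pose X := (v 0 0 - x1) / (x2 - x1).
  have XE : v 0 0 = x1 + (x2 - x1) * X by rewrite /X; field; rewrite subr_eq0 gt_eqF.
  have X0 : 0 <= X by rewrite /X divr_ge0; lra.
  have X1 : X <= 1 by rewrite /X ler_pdivrMr; lra.
  suff [t t01 [tX ty]] : exists2 t, 0 <= t <= 1 & A t = X /\ B t = y.
    exists t; first by rewrite in_itv.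
    by apply: vec_eq; rewrite ?vec0 ?vec1 ?tX ?ty.
  (* A boundary point lies on one of the four sides; the times supplied below invert the
     parametrization on that side. *)
  have find t X' y' : 0 <= t <= 1 -> X = X' -> y = y' -> (A t = X' /\ B t = y') ->
    exists2 t, 0 <= t <= 1 & A t = X /\ B t = y by move=> ? -> -> ?; exists t.
  have [y0|y0] := eqVneq y 0.
    apply: (find (X / 4) X 0) => //; first lra.
    by case: (@quarter (X / 4)) => [|[? [-> ->]]|[? [-> ->]]|[? [-> ->]]|[? [-> ->]]]; lra.
  have [y1|y1] := eqVneq y 1.
    apply: (find ((3 - X) / 4) X 1) => //; first lra.
    by case: (@quarter ((3 - X) / 4)) => [|[? [-> ->]]|[? [-> ->]]|[? [-> ->]]|[? [-> ->]]]; lra.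
  have y01 : 0 < y < 1 by move: vy y0 y1; rewrite !lt_neqAle eq_sym => /andP[-> ->] -> ->.
  have [X_0|X_0] := eqVneq X 0.
    apply: (find ((4 - y) / 4) 0 y) => //; first lra.
    by case: (@quarter ((4 - y) / 4)) => [|[? [-> ->]]|[? [-> ->]]|[? [-> ->]]|[? [-> ->]]]; lra.
  have [X_1|X_1] := eqVneq X 1.
    apply: (find ((1 + y) / 4) 1 y) => //; first lra.
    by case: (@quarter ((1 + y) / 4)) => [|[? [-> ->]]|[? [-> ->]]|[? [-> ->]]|[? [-> ->]]]; lra.
  have X01 : 0 < X < 1 by rewrite !lt_neqAle X0 X1 X_1 eq_sym X_0.
  by case: vb; split => //; rewrite XE; apply/andP; split; nra.
have x12' := x12; move=> [t]; rewrite in_itv /= => t01 <-; rewrite /rectangle /= vec0 vec1.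
by case: (quarter t01) => -[? [-> ->]]; split => [|[]]; try split; try nra; lra.
Qed.

End Rectangle.

(** * Derivatives relative to the square *)

Section Differentiability.
Context {R : realType}.

Lemma vec_mulmx (u : 'rV[R]_2) (A : 'M[R]_(2, 3)) :
  u *m A = u 0 0 *: row 0 A + u 0 1 *: row 1 A.
Proof.
rewrite mulmx_sum_row big_ord_recl big_ord1 (_ : lift ord0 ord0 = 1) //.
exact: val_inj.
Qed.

Lemma differentiable_in_square_locally_affine (F : 'rV[R]_2 -> 'rV[R]_3) x
    (A : 'M[R]_(2, 3)) :
  (\forall y \near x, F y - F x = (y - x) *m A) -> differentiable_in_square F x.
Proof.
move=> FA; exists A; apply/eqoP => eps eps0; apply: cvg_within.
apply: (@filterS _ (nbhs x) _ _ _ _ FA) => y /= ->.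
by rewrite subrr normr0 mulr_ge0 // ltW.
Qed.

(** Only the ray [t > 0] enters, so the two sides of a crease can be tested separately, with
    opposite directions [u]. *)
Lemma derivative_along (F : 'rV[R]_2 -> 'rV[R]_3) x (A : 'M[R]_(2, 3)) u g t0 :
  (forall eps, 0 < eps -> \forall y \near within (unit_square R) (nbhs x),
    `|F y - F x - (y - x) *m A| <= eps * `|y - x|) ->
  0 < t0 ->
  (forall t, 0 < t < t0 -> unit_square R (x + t *: u) /\ F (x + t *: u) - F x = t *: g) ->
  g = u *m A.
Proof.
move=> FA t0_gt0 Fu; apply/eqP; rewrite -subr_eq0 -normr_le0.
apply/ler_addgt0Pl => eps eps0; rewrite addr0.
pose d := eps / (`|u| + 1).
have u1 : 0 < `|u| + 1 by rewrite ltr_wpDl.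
have d0 : 0 < d by rewrite divr_gt0.
have xu : x + t *: u @[t --> 0^'+] --> x.
  suff : x + t *: u @[t --> 0^'+] --> x + 0 *: u by rewrite scale0r addr0.
  apply: cvgD; first exact: cvg_cst.
  by apply: cvgZ; [exact: cvg_at_right_filter|exact: cvg_cst].
have near_t := xu _ (FA d d0).
have : \forall t \near (0 : R)^'+, `|g - u *m A| <= d * `|u|.
  near=> t.
  have t_gt0 : 0 < t by near: t; exact: nbhs_right_gt.
  have tt0 : t < t0 by near: t; exact: nbhs_right_lt.
  have [|sq Ft] := Fu t; first by rewrite t_gt0.
  have : unit_square R (x + t *: u) ->
    `|F (x + t *: u) - F x - (x + t *: u - x) *m A| <= d * `|x + t *: u - x|.
    by near: t.
  move=> /(_ sq); rewrite Ft addrAC subrr add0r -scalemxAl -scalerBr !normrZ.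
  by rewrite mulrCA ler_pM2l // normr_gt0 gt_eqF.
move=> /filter_ex[_ le_d]; apply: le_trans le_d _.
by rewrite /d mulrAC ler_pdivrMr // ler_pM2l // lerDl.
Unshelve. all: by end_near. Qed.

End Differentiability.

(** * The crease pattern of the cylinder *)

Section FoldCreases.
Context {R : realType}.
Variables (n : nat) (a : nat -> R) (e : nat -> 'rV[R]_2) (V : 'rV[R]_2).
Hypotheses (n0 : (0 < n)%N) (a0 : a 0%N = 0) (a1 : a n = 1).
Hypothesis (an : increasing_upto n a).
Hypothesis e1 : forall i, (i < n)%N -> dot (e i) (e i) = 1.

Let F := fold a e V n.

(** Consecutive segments may point in the same direction; over such a vertex the folding is
    differentiable and no edge is listed. *)
Definition creases := [seq i <- iota 1 n.-1 | e i != e i.-1].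

Lemma mem_creases i : (i \in creases) = [&& (0 < i)%N, (i < n)%N & e i != e i.-1].
Proof.
by rewrite mem_filter mem_iota add1n prednK // andbC andbA.
Qed.

(** Each added hinge either has coefficient 0 or has [x] strictly on one of its sides, and in both
    cases it is affine near [x]. *)
Lemma pl_near m (x : R) : (m <= n)%N ->
  (forall i, (i < m)%N -> i \in creases -> x != a i) ->
  exists d, \forall y \near x, pl a e m y - pl a e m x = (y - x) *: d.
Proof.
case: m => [|m] mn xa.
  by exists (e 0%N); apply: (@filterE _ (nbhs x)) => y; rewrite /pl !big_geq // !addr0 scalerBl.
elim: m mn xa => [|m IH] mn xa.
  by exists (e 0%N); apply: (@filterE _ (nbhs x)) => y; rewrite /pl !big_geq // !addr0 scalerBl.
have [||d dP] := IH; [exact: ltnW|by move=> i im; apply: xa; apply: ltnW|].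
have plS y : pl a e m.+2 y = pl a e m.+1 y + Num.max (y - a m.+1) 0 *: (e m.+1 - e m).
  by rewrite /pl big_nat_recr //= addrA.
have [em|em] := eqVneq (e m.+1) (e m).
  by exists d; near=> y; rewrite !plS em subrr !scaler0 !addr0; near: y.
have := xa m.+1 (ltnSn _); rewrite mem_creases /= mn em => /(_ isT).
rewrite neq_lt => /orP[xm|xm].
  exists d; near=> y.
  have ym : y < a m.+1 by near: y; exact: lt_nbhsl.
  by rewrite !plS !max_r ?subr_le0 ?ltW // scale0r !addr0; near: y.
exists (d + (e m.+1 - e m)); near=> y.
have ym : a m.+1 < y by near: y; exact: lt_nbhsr.
rewrite !plS !max_l ?subr_ge0 ?ltW // opprD addrACA -scalerBl [RHS]scalerDr.
congr (_ + _ *: _); last by ring.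
by near: y.
Unshelve. all: by end_near. Qed.

Lemma fold_differentiable (x : 'rV[R]_2) :
  (forall i, i \in creases -> x 0 0 != a i) -> differentiable_in_square F x.
Proof.
move=> xa; have [|d dP] := @pl_near n (x 0 0) (leqnn n).
  by move=> i _; apply: xa.
pose A : 'M[R]_(2, 3) := \matrix_(i, j) (if i == 0 then point d 0 else point 0 1) 0 j.
have rowA : row 0 A = point d 0 /\ row 1 A = point 0 1.
  by split; apply/rowP => j; rewrite !mxE.
apply: (@differentiable_in_square_locally_affine _ _ _ A).
have dP' : nbhs x [set y : 'rV[R]_2 |
    pl a e n (y 0 0) - pl a e n (x 0 0) = (y 0 0 - x 0 0) *: d].
  exact: (@coord_continuous R _ _ 0 0 x _ dP).
apply: (@filterS _ (nbhs x) _ _ _ _ dP') => y /= yx.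
rewrite vec_mulmx (proj1 rowA) (proj2 rowA) /F /fold pointB opprD addrACA subrr add0r yx.
by rewrite -!pointZ pointD scaler0 addr0 mulr0 add0r mulr1 !mxE.
Qed.

(** A derivative would have to send the right unit vector to the slope [e i] and the left one to
    [- e i.-1], which forces the two slopes to agree. The neighbouring breakpoints leave room in the
    square on both sides. *)
Lemma fold_not_differentiable i (x : 'rV[R]_2) :
  i \in creases -> unit_square R x -> x 0 0 = a i -> ~ differentiable_in_square F x.
Proof.
rewrite mem_creases => /and3P[i0 ni ei] sqx xi [A /eqoP FA].
have i1n : (i.-1 < n)%N by apply: leq_ltn_trans ni; apply: leq_pred.
have iE : i.-1.+1 = i by rewrite prednK.
have ai1 : a i < a i.+1 by apply: an.
have ai0 : a i.-1 < a i by rewrite -[in X in _ < X]iE an.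
have a_lt1 : a i.+1 <= 1 by rewrite -a1; apply: increasing_upto_le an _; rewrite ni leqnn.
have a_ge0 : 0 <= a i.-1 by rewrite -a0; apply: increasing_upto_le an _; rewrite leq0n ltnW.
have sq (t s : R) : 0 <= x 0 0 + t * s <= 1 -> unit_square R (x + t *: vec s 0).
  move=> ts j; rewrite !mxE; case: ifP => [/eqP ->|j0]; first by rewrite in_itv.
  by rewrite mulr0 addr0.
have piece k y : (k < n)%N -> a k <= y <= a k.+1 ->
    pl a e n y = pl a e n (a k) + (y - a k) *: e k by exact: pl_piece.
have slope_r : point (e i) 0 = vec 1 0 *m A.
  apply: (derivative_along (t0 := a i.+1 - a i) FA); first by rewrite subr_gt0.
  move=> t /andP[t0 tt0]; split; first by apply: sq; rewrite mulr1 xi; lra.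
  rewrite /F /fold pointB !mxE /= mulr0 mulr1 addr0 subrr xi opprD addrACA subrr add0r.
  rewrite (@piece i) //; last by lra.
  rewrite addrAC subrr add0r [a i + t]addrC addrK.
  by rewrite -[0 in LHS](mulr0 t) pointZ.
have slope_l : point (- e i.-1) 0 = vec (-1) 0 *m A.
  apply: (derivative_along (t0 := a i - a i.-1) FA); first by rewrite subr_gt0.
  move=> t /andP[t0 tt0]; split; first by apply: sq; rewrite mulrN1 xi; lra.
  rewrite /F /fold pointB !mxE /= mulr0 mulrN1 addr0 subrr xi opprD addrACA subrr add0r.
  rewrite (@piece i.-1 (a i - t) i1n); last by rewrite iE; lra.
  rewrite [pl a e n (a i)](@piece i.-1 (a i) i1n); last by rewrite iE lexx ltW.
  rewrite opprD addrACA subrr add0r -scalerBl.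
  have -> : a i - t - a i.-1 - (a i - a i.-1) = - t by ring.
  by rewrite scaleNr -scalerN -[0 in LHS](mulr0 t) pointZ.
have : vec (-1) 0 = - vec 1 0 :> 'rV[R]_2 by apply: vec_eq; rewrite !mxE ?oppr0.
move=> vE; have : point (- e i.-1) 0 = point (- e i) 0.
  by rewrite slope_l vE mulNmx -slope_r -scaleN1r -pointZ scaleN1r mulr0.
by move=> /point_inj[/oppr_inj ee _]; rewrite ee eqxx in ei.
Qed.

Definition crease_vertices :=
  [seq vec (a i) 0 | i <- creases] ++ [seq vec (a i) 1 | i <- creases].

Definition crease_edges := [seq (vec (a i) 0, vec (a i) 1) | i <- creases].

Lemma crease_segment (x t : R) :
  vec x 0 + t *: (vec x 1 - vec x 0) = vec x t.
Proof. by apply: vec_eq; rewrite !mxE /=; ring. Qed.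

Lemma crease_edge_ends ed : ed \in crease_edges ->
  [/\ ed.1 \in crease_vertices, ed.2 \in crease_vertices & ed.1 != ed.2].
Proof.
move=> /mapP[i ic ->] /=; rewrite !mem_cat.
have /= -> := map_f (fun i => vec (a i) 0) ic.
have /= -> := map_f (fun i => vec (a i) 1) ic; rewrite orbT; split => //.
by apply/eqP => /(congr1 (fun v : 'rV[R]_2 => v 0 1)); rewrite !vec1 => /eqP;
  rewrite eq_sym oner_eq0.
Qed.

Lemma crease_edge_avoids_vertices ed v :
  ed \in crease_edges -> v \in crease_vertices -> ~ open_segment ed v.
Proof.
move=> /mapP[i ic ->] vV [t]; rewrite /= crease_segment in_itv /= => t01 vE.
by move: vV; rewrite mem_cat => /orP[] /mapP[j _]; rewrite -vE =>
  /(congr1 (fun v : 'rV[R]_2 => v 0 1)); rewrite !vec1; lra.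
Qed.

Lemma crease_edges_disjoint i j : (i < j < size crease_edges)%N ->
  open_segment (nth (0, 0) crease_edges i) `&`
  open_segment (nth (0, 0) crease_edges j) = set0.
Proof.
move=> /andP[ij]; rewrite size_map => js; have is_ := ltn_trans ij js.
rewrite -subset0 => v [] /=; rewrite /crease_edges !(nth_map 0%N) // => -[t _ <-] [u _].
rewrite !crease_segment => /(congr1 (fun v : 'rV[R]_2 => v 0 0)); rewrite !vec0.
set k := nth _ _ j; set l := nth _ _ i.
have /and3P[_ kn _] : [&& (0 < k)%N, (k < n)%N & e k != e k.-1].
  by rewrite -mem_creases mem_nth.
have /and3P[_ ln _] : [&& (0 < l)%N, (l < n)%N & e l != e l.-1].
  by rewrite -mem_creases mem_nth.
have kl : k != l.
  rewrite /k /l nth_uniq // ?(gtn_eqF ij) //.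
  by rewrite filter_uniq // iota_uniq.
move: kl; rewrite neq_ltn => /orP[kl|kl] ak.
  by have := increasing_upto_lt an (_ : (k < l <= n)%N); rewrite kl ltnW // ak ltxx => /(_ isT).
by have := increasing_upto_lt an (_ : (l < k <= n)%N); rewrite kl ltnW // ak ltxx => /(_ isT).
Qed.

Definition crease_graph :=
  StraightGraph crease_edge_ends crease_edge_avoids_vertices crease_edges_disjoint.

Lemma size_crease_graph : (size (edges crease_graph) <= n)%N.
Proof.
rewrite /= size_map size_filter (leq_trans (count_size _ _)) // size_iota.
exact: leq_pred.
Qed.

Lemma fold_crease_pattern : crease_pattern F crease_graph.
Proof.
apply/seteqP; split => x /=.
  suff : (exists2 i, i \in creases & x 0 0 = a i /\ 0 <= x 0 1 <= 1) ->
      unit_square R x /\ ~ differentiable_in_square F x.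
    move=> H [|[ed /mapP[i ic ->] [t]]]; last first.
      rewrite /= crease_segment in_itv /= => t01 xE; apply: H; exists i => //.
      by rewrite -xE vec0 vec1.
    rewrite mem_cat => /orP[] /mapP[i ic xE]; apply: H; exists i => //;
      by rewrite xE vec0 vec1 ?lexx ?ler01.
  move=> [i ic [x0 x1]].
  have sq : unit_square R x.
    move: ic; rewrite mem_creases => /and3P[_ ni _] j.
    have [->|j0] := eqVneq j 0.
      rewrite in_itv /= x0 -a0 -a1; apply/andP.
      by split; apply: increasing_upto_le an _; rewrite ?leqnn ?andbT ?leq0n /= ltnW.
    rewrite (_ : j = 1) ?in_itv //.
    by apply: val_inj; case: j j0 => [[|[|]]].
  by split => //; apply: fold_not_differentiable ic sq x0.
move=> [sq nd]; right.
have [/hasP[i ic /eqP xi]|/hasPn nc] := boolP (has (fun i => x 0 0 == a i) creases).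
  exists (vec (a i) 0, vec (a i) 1).
    exact: (map_f (fun i => (vec (a i) 0, vec (a i) 1))).
  exists (x 0 1); first exact: sq.
  by rewrite crease_segment [RHS]vec_coord xi.
by case: nd; apply: fold_differentiable.
Qed.

Lemma fold_origami : origami_folding F.
Proof.
split; last first.
  move=> p pc _; apply: fold_arc_length => //.
have Fc : continuous F.
  apply: continuous_along => T G f v FG fv; apply: cvg_point; last exact: cvg_coord.
  apply: cvgD; first exact: cvg_cst.
  by apply: cvg_pl; apply: cvg_coord.
split; first exact: continuous_subspaceT.
exists (mkseq (fun k => rectangle (a k) (a k.+1)) n); rewrite size_mkseq; split.
- by move=> i ni; rewrite nth_mkseq //; apply: rectangle_polygon; apply: an.
- move=> i j ni nj; wlog ij : i j ni nj / (i < j)%N => [IH|].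
    by rewrite neq_ltn => /orP[ij|ij]; [|rewrite setIC]; apply: IH => //; rewrite ltn_eqF.
  move=> _; rewrite !nth_mkseq // !interior_rectangle ?an // -subset0 => v [] /=.
  have : a i.+1 <= a j by apply: increasing_upto_le an _; rewrite ij ltnW.
  by move=> aij [/andP[_ vi] _] [/andP[vj _] _]; have := lt_trans vj vi; rewrite ltNge aij.
- apply/seteqP; split => v.
    move=> [i /= ni]; rewrite nth_mkseq // => -[vi v1] j.
    have [->|j0] := eqVneq j 0.
      have ai : a 0%N <= a i by apply: increasing_upto_le an _; rewrite leq0n ltnW.
      have ai1 : a i.+1 <= a n by apply: increasing_upto_le an _; rewrite ni leqnn.
      by rewrite in_itv /=; move: ai ai1; rewrite a0 a1; lra.
    rewrite (_ : j = 1) ?in_itv //.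
    by apply: val_inj; case: j j0 => [[|[|]]].
  move=> sq; have := sq 0; have := sq 1; rewrite !in_itv /= => v1 v0.
  have [|k kn vk] := @locate_piece _ n a (v 0 0) n0; first by rewrite a0 a1.
  by exists k => //; rewrite nth_mkseq.
- move=> i ni; rewrite nth_mkseq //.
  pose A : 'M[R]_(2, 3) := \matrix_(k, j) (if k == 0 then point (e i) 0 else point 0 1) 0 j.
  have rowA : row 0 A = point (e i) 0 /\ row 1 A = point 0 1.
    by split; apply/rowP => j; rewrite !mxE.
  exists A, (point (V + pl a e n (a i) - a i *: e i) 0) => v [vi _].
  rewrite vec_mulmx (proj1 rowA) (proj2 rowA) -!pointZ !pointD /F /fold.
  rewrite (@pl_piece _ _ _ _ _ i) // scaler0 addr0 !mulr0 add0r mulr1 addr0; congr point.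
  by rewrite scalerBl [RHS]addrC !addrA addrAC.
Qed.

End FoldCreases.

(** * From a diagram to a folded loop *)

Section Extension.
Context {R : realType}.

(** [w] descends to a function [f] on the compact curve. It is continuous because preimages of
    closed sets under [f] are images under [g] of compact sets, hence closed. The extreme values of
    [w] give the bound for the bounded form of Tietze's theorem. *)
Lemma factor_extension (g : R -> 'rV[R]_2) (w : R -> R) :
  continuous g -> {within `[0, 1], continuous w} ->
  (forall x y, x \in `[0, 1] -> y \in `[0, 1] -> g x = g y -> w x = w y) ->
  exists2 W : 'rV[R]_2 -> R, continuous W & forall x, x \in `[0, 1] -> W (g x) = w x.
Proof.
move=> gc wc gw; pose I := `[(0 : R), 1]%classic; pose A := g @` I.
have Ic : compact I by apply: segment_compact.
have compact_g B : compact B -> compact (g @` B).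
  by move=> Bc; apply: continuous_compact => //; apply: continuous_subspaceT.
have closed_g B : compact B -> closed (g @` B).
  by move=> /compact_g Bc; apply: compact_closed => //; apply: norm_hausdorff.
pose f p := w (xget 0 [set x | I x /\ g x = p]).
have fg x : I x -> f (g x) = w x.
  move=> Ix; have [Iy gy] := @xgetPex _ 0 [set y | I y /\ g y = g x] (ex_intro _ x (conj Ix erefl)).
  by apply: gw.
have fc : {within A, continuous f}.
  apply/continuous_closedP => Z Zc; apply/closed_subspaceP.
  have /closed_subspaceP[Z' Z'c Z'E] := (continuous_closedP _).1 wc Z Zc.
  exists (g @` (I `&` Z')); first by apply: closed_g; apply: compact_closedI.
  apply/seteqP; split => p [].
    move=> [x [Ix Z'x] xp] Ap; split; last exact: Ap.
    have : (Z' `&` I) x by split.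
    by rewrite Z'E => -[Zx _]; have Zfp : Z (f p) by rewrite -xp fg.
  move=> Zp [x Ix xp]; split; last by exists x.
  exists x => //; split => //; have : (w @^-1` Z `&` I) x.
    by split => //; have Zwx : Z (w x) by rewrite -fg // xp.
  by rewrite -Z'E => -[].
have [M M0 fM] : exists2 M : R, 0 < M & forall p, A p -> `|f p| <= M.
  have [c cI cM] := EVT_max ler01 wc; have [d dI dM] := EVT_min ler01 wc.
  exists (`|w c| + `|w d| + 1); first by rewrite ltr_wpDl // addr_ge0.
  move=> _ [x Ix <-]; rewrite fg // ler_norml.
  have := cM x Ix; have := dM x Ix; have := ler_norm (w c); have := ler_norm (- w d).
  have := normr_ge0 (w c); have := normr_ge0 (w d); rewrite normrN.
  by move=> *; apply/andP; split; lra.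
have [W [fW Wc _]] := continuous_bounded_extension pseudometric_normal (closed_g _ Ic) M0 fc fM.
exists W => // x Ix; rewrite -(fW (g x)); first exact: fg.
by rewrite inE; exists x.
Qed.

Lemma seq_gt_bound (s : seq R) (c : R) : (forall x, x \in s -> c < x) ->
  exists2 d, c < d & forall x, x \in s -> d < x.
Proof.
elim: s => [_|x s IH sc]; first by exists (c + 1); [rewrite ltrDl|].
have [|d cd sd] := IH; first by move=> y ys; apply: sc; rewrite inE ys orbT.
have cx : c < x by apply: sc; rewrite inE eqxx.
exists (Num.min d ((c + x) / 2)); first by rewrite lt_min cd /=; lra.
move=> y; rewrite inE => /orP[/eqP ->|/sd ?]; rewrite gt_min.
  by apply/orP; right; lra.
by apply/orP; left.
Qed.

Lemma seq_lt_bound (s : seq R) (c : R) : (forall x, x \in s -> x < c) ->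
  exists2 d, d < c & forall x, x \in s -> x < d.
Proof.
move=> sc; have [|d cd sd] := @seq_gt_bound (map -%R s) (- c).
  by move=> _ /mapP[x /sc xc ->]; rewrite ltrN2.
exists (- d); first by rewrite ltrNl.
by move=> x xs; rewrite ltrNr; apply: sd; apply: map_f.
Qed.

(** Two outer ramps use the heights above 1/2, and everything between [d] and [q] stays below. No
    piece of [N] straddles [d] or [q], so a second coordinate with a corner at [q] is still affine
    along [N]. *)
Lemma height_profile (d q : R) (s : seq R) (g : R -> R) :
  0 < d -> d < q -> q < 1 -> (forall x, x \in s -> d < x < q) ->
  (forall x, x \in s -> 0 <= g x <= 1 / 2) ->
  exists (N : seq R) (y : R -> R),
    [/\ itv_partition 0 1 N, continuous y,
      (forall i, (i < size N)%N -> exists u v : R,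
        forall t, t \in `[nth 0 (0 :: N) i, nth 0 N i] -> y t = u + t * v),
      (forall x, x \in s -> y x = g x) &
      (forall i, (i < size N)%N -> [\/ nth 0 N i <= d,
        d <= nth 0 (0 :: N) i /\ nth 0 N i <= q | q <= nth 0 (0 :: N) i])] /\
    [/\ forall x, 0 <= x <= d -> y x = 1 - x / (2 * d),
      forall x, d <= x <= q -> 0 <= y x <= 1 / 2 &
      forall x, q <= x <= 1 -> y x = 1 - (1 - x) / (2 * (1 - q))].
Proof.
move=> d0 dq q1 sdq sg.
pose S := sort <=%O (undup s).
have SE x : (x \in S) = (x \in s) by rewrite mem_sort mem_undup.
pose N := d :: S ++ [:: q; 1].
have N_path : path <%R 0 N.
  rewrite /= d0 /= cat_path (path_sortedE lt_trans) sort_lt_sorted undup_uniq andbT /=.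
  rewrite q1 andbT andbT; apply/andP; split.
    by apply/allP => x; rewrite SE => /sdq /andP[].
  have := mem_last d S; rewrite inE SE => /orP[/eqP ->|/sdq /andP[]] //.
have Np : itv_partition 0 1 N by split => //=; rewrite last_cat.
pose b := nth 0 (0 :: N).
have b0 : b 0%N = 0 by [].
have bn : increasing_upto (size N) b by apply: itv_partition_nthS.
have sN : size N = (size S).+3 by rewrite /= size_cat addn2.
have bS i : (i < size S)%N -> b i.+2 = nth 0 S i.
  by move=> iS; rewrite /b /= nth_cat iS.
have bq : b (size S).+2 = q by rewrite /b /= nth_cat ltnn subnn.
have b1 : b (size S).+3 = 1 by rewrite /b /= nth_cat ltnNge leqnSn /= subSnn.
(* Values at the breakpoints: 1 at both ends, 1/2 at the feet of the ramps, and the prescribed ones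
   on [s]. *)
pose G x := if (x == 0) || (x == 1) then 1 else if (x == d) || (x == q) then 1 / 2 else g x.
have G0 : G 0 = 1 by rewrite /G eqxx.
have G1 : G 1 = 1 by rewrite /G eqxx orbT.
have Gd : G d = 1 / 2 by rewrite /G eqxx (gt_eqF d0) (lt_eqF (lt_trans dq q1)).
have Gq : G q = 1 / 2 by rewrite /G eqxx (gt_eqF (lt_trans d0 dq)) (lt_eqF q1) orbT.
have Gs x : x \in s -> G x = g x.
  move=> /sdq /andP[dx xq]; rewrite /G (gt_eqF (lt_trans d0 dx)) (lt_eqF (lt_trans xq q1)) /=.
  by rewrite (gt_eqF dx) (lt_eqF xq).
pose Y i := G (b i) : R^o.
pose y x := Y 0%N + pl b (interp_slope b Y) (size N) x.
have yb i : (i <= size N)%N -> y (b i) = G (b i) by move=> iN; apply: interp_knot.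
have yp i x : (i < size N)%N -> b i <= x <= b i.+1 ->
    y x = G (b i) + (x - b i) * ((b i.+1 - b i)^-1 * (G (b i.+1) - G (b i))).
  move=> iN bx; rewrite /y (pl_piece _ bn iN bx) addrA.
  by congr (_ + _); apply: yb; apply: ltnW.
have mid i : (1 <= i <= (size S).+2)%N -> d <= b i <= q /\ 0 <= G (b i) <= 1 / 2.
  case: i => [|[|i]] // /andP[_ iS]; first by rewrite /b /= Gd; split; lra.
  move: iS; rewrite 2!ltnS leq_eqVlt => /orP[/eqP ->|iS].
    by rewrite bq Gq; split; lra.
  rewrite bS //; have xs : nth 0 S i \in s by rewrite -SE mem_nth.
  by rewrite Gs //; have := sdq _ xs; have := sg _ xs; split; lra.
exists N, y; split; split => //.
- by apply: continuous_along => T F f x FF fx; apply: (@cvgD _ R^o); [exact: cvg_cst|exact: cvg_pl].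
- move=> i iN; set m := (b i.+1 - b i)^-1 * (G (b i.+1) - G (b i)).
  exists (G (b i) - b i * m), m => t; rewrite in_itv /= => ti.
  by rewrite (yp i) // -/m; ring.
- move=> x xs; have /(nthP 0)[i iS <-] : x \in S by rewrite SE.
  rewrite -bS // yb; last by rewrite sN !ltnS; apply: leq_trans (ltnW iS) (leqnSn _).
  by rewrite bS // Gs // -SE mem_nth.
- move=> i; rewrite sN => iN; rewrite -[nth 0 N i]/(b i.+1) -/(b i).
  have [i0|i0] := posnP i; first by rewrite i0; constructor 1.
  have [iS|iS] := eqVneq i (size S).+2; first by rewrite iS bq; constructor 3.
  have iS2 : (i < (size S).+2)%N by lia.
  constructor 2; split.
    by have [|/andP[]] := mid i; first by rewrite i0 ltnW.
  by have [|/andP[]] := mid i.+1.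
- move=> x xd; rewrite (yp 0%N) //; rewrite -[b 1%N]/d b0 G0 Gd; field.
  by rewrite gt_eqF.
- move=> x /andP[dx xq].
  have [|i iN bx] := @locate_piece _ (size N) b x isT.
    by rewrite b0 sN b1; apply/andP; split; lra.
  (* When [x] is [d] or [q], the piece found may be one of the ramps; the adjacent inner piece
     contains [x] too. *)
  have [k kS bk] : exists2 k, (1 <= k < (size S).+2)%N & b k <= x <= b k.+1.
    have [i0|i0] := posnP i.
      exists 1%N => //; move: bx; rewrite i0 -[b 1%N]/d => /andP[_ xd].
      have -> : x = d by apply/eqP; rewrite eq_le xd dx.
      by rewrite lexx ltW //; apply: (bn 1%N); rewrite sN.
    have [iS|iS] := eqVneq i (size S).+2.
      exists (size S).+1; [by rewrite ltnSn|move: bx; rewrite iS bq => /andP[qx _]].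
      have -> : x = q by apply/eqP; rewrite eq_le xq qx.
      by rewrite lexx -[in X in _ <= X]bq ltW //; apply: bn; rewrite sN.
    by exists i => //; move: iN; rewrite sN; lia.
  move: kS => /andP[k1 kS]; have kN : (k < size N)%N by rewrite sN ltnW.
  have bx0 := bk; rewrite (yp k) //; have [|_] := mid k; first by rewrite k1 ltnW.
  have [|_] := mid k.+1; first by [].
  have := bn _ kN; set m := (b k.+1 - b k)^-1; rewrite -subr_gt0 => bk0.
  have := mulVf (lt0r_neq0 bk0); rewrite -/m => mE.
  set l := (x - b k) * m.
  have m0 : 0 < m by rewrite invr_gt0.
  have [l0 l1] : 0 <= l /\ l <= 1 by move: bx0 => /andP[? ?]; rewrite /l; split; nra.
  rewrite mulrA -/l; move: (G _) (G _) => G1' G2' ? ?; apply/andP; split; nra.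
- move=> x xq; rewrite (yp (size S).+2) ?sN ?bq ?b1 // G1 Gq; field.
  by rewrite !subr_eq0 gt_eqF.
Qed.

End Extension.

(** * The folded loop and its isotopy to the lifted diagram *)

Section FoldKnot.
Context {R : realType}.

Definition trace (a : nat -> R) (e : nat -> 'rV[R]_2) V n X := V + pl a e n X.

(* A diagram parametrized by arc length from an exposed vertex V, which is the
   point of the curve with the largest norm. *)
Record arc_diagram n (a : nat -> R) (e : nat -> 'rV[R]_2) V (h : R -> R) : Prop :=
  ArcDiagram {
  arc_size : (0 < n)%N;
  arc_start : a 0%N = 0;
  arc_end : a n = 1;
  arc_increasing : increasing_upto n a;
  arc_unit : forall i, (i < n)%N -> dot (e i) (e i) = 1;
  arc_closed : trace a e V n 1 = V;
  arc_height : {within `[0, 1], continuous h};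
  arc_height_closed : h 0 = h 1;
  arc_simple : forall x y, x \in `[0, 1[ -> y \in `[0, 1[ ->
    trace a e V n x = trace a e V n y -> h x = h y -> x = y;
  arc_regular : forall x y, double_point (trace a e V n) x y ->
    forall i, (i < n)%N -> x != a i;
  arc_finite : finite_set [set x | exists y, double_point (trace a e V n) x y];
  arc_exposed : forall x, 0 < x < 1 -> 0 < dot V (V - trace a e V n x) }.

Lemma continuous_trace a e V n : continuous (trace a e V n).
Proof.
move=> x; apply: (@cvgD _ _ _ (nbhs x) _ (fun=> V) (pl a e n)).
  exact: cvg_cst.
exact: continuous_pl.
Qed.

Lemma fold_trace a e V n v : fold a e V n v = point (trace a e V n (v 0 0)) (v 0 1).
Proof. by []. Qed.

Section Loop.
Variables (n : nat) (a : nat -> R) (e : nat -> 'rV[R]_2) (V : 'rV[R]_2) (h : R -> R).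
Hypothesis arc : arc_diagram n a e V h.
Let g := trace a e V n.

Let n0 := arc_size arc.
Let a0 := arc_start arc.
Let a1 := arc_end arc.
Let an := arc_increasing arc.

Lemma trace0 : g 0 = V.
Proof. by rewrite /g /trace pl0 // addr0. Qed.

Lemma trace_first x : 0 <= x <= a 1%N -> g x = V + x *: e 0%N.
Proof.
move=> xa; rewrite /g /trace (pl_piece _ an n0) ?a0 // pl0 //.
by rewrite add0r subr0.
Qed.

Lemma trace_last x : a n.-1 <= x <= 1 -> g x = V - (1 - x) *: e n.-1.
Proof.
move=> /andP[xa x1].
have nn : (n.-1 < n)%N by rewrite prednK.
have p y : a n.-1 <= y <= 1 -> pl a e n y = pl a e n (a n.-1) + (y - a n.-1) *: e n.-1.
  by move=> ya; apply: pl_piece => //; rewrite prednK // a1.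
have a1n : a n.-1 <= 1 by apply: le_trans x1.
have := arc_closed arc; rewrite /g /trace p ?a1n ?lexx // => gE.
rewrite -[in RHS]gE p ?xa //; move: (pl _ _ _ _) => P; rewrite -!addrA -scalerBl.
by congr (_ + (_ + _ *: _)); ring.
Qed.

(** A single segment of unit slope cannot return to its starting point. *)
Lemma arc_size_gt1 : (1 < n)%N.
Proof.
rewrite ltn_neqAle n0 andbT; apply/eqP => n1.
have e0 : e 0%N = 0.
  apply: (@addrI _ V); rewrite addr0 -[in LHS](scale1r (e 0%N)) -trace_first.
    exact: arc_closed arc.
  by rewrite n1 a1 ler01 lexx.
have := arc_unit arc n0; rewrite e0 -(scale0r 0) dotZl mul0r => /eqP.
by rewrite eq_sym oner_eq0.
Qed.

Let exposed x := dot (g x - V) (- V).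

Let exposedE x : exposed x = dot V (V - g x).
Proof. by rewrite /exposed dotNr -dotNl opprB dotC. Qed.

Let slide (p u v : 'rV[R]_2) (x c : R) : c != 0 ->
  p + x *: u + (x * c) *: (c^-1 *: (v - u)) = p + x *: v.
Proof.
move=> c0; rewrite scalerA mulfK // scalerBr [x *: v - _]addrC addrA.
by rewrite addrK.
Qed.

Lemma level_map_inj (C p q w : 'rV[R]_2) k : 0 < 1 + dot w C ->
  p + (dot p C - k) *: w = q + (dot q C - k) *: w -> p = q.
Proof.
move=> wC pq; have := congr1 (dot^~ C) pq; rewrite !dotDl !dotZl => pqC.
have E : dot p C = dot q C.
  apply/eqP; rewrite -subr_eq0; apply/eqP; apply: (mulIf (lt0r_neq0 wC)).
  by rewrite mul0r; move: pqC; lra.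
by move: pq; rewrite E => /addIr.
Qed.

Opaque trace dot fold.

Let doubles := [set x | exists y, double_point g x y].

Let kappa := dot (e 0%N) (- V).

Let a_first : 0 < a 1%N.
Proof. by rewrite -a0; apply: an. Qed.

Let a_first_lt1 : a 1%N < 1.
Proof. by rewrite -a1; apply: increasing_upto_lt an _; rewrite arc_size_gt1 leqnn. Qed.

Let exposed_gt0 x : 0 < x < 1 -> 0 < exposed x.
Proof. by move=> x01; rewrite exposedE; apply: arc_exposed arc _ x01. Qed.

Let exposed_first x : 0 <= x <= a 1%N -> exposed x = x * kappa.
Proof. by move=> xa; rewrite /exposed trace_first // addrC addKr dotZl. Qed.

Let kappa_gt0 : 0 < kappa.
Proof.
have : 0 < exposed (a 1%N) by apply: exposed_gt0; rewrite a_first.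
by rewrite exposed_first ?pmulr_rgt0 // lexx ltW.
Qed.

(* The return strand runs over [0, q] and ends at V together with the strand of
   slope kappa * d / q; the last clause says that, at each height, the return
   strand stays strictly farther from V. *)
Let exists_cut : exists (s : seq R) (d q : R),
  [/\ doubles = [set` s], forall x, x \in s -> d < x < q,
      [/\ 0 < d, d < a 1%N, a 1%N <= q, a n.-1 <= q & q < 1] &
      forall x, a 1%N <= x <= q -> kappa * d / q < exposed x / x].
Proof.
have /finite_seqP[s sE] := arc_finite arc.
have s01 x : x \in s -> 0 < x < 1.
  move=> xs; have : doubles x by rewrite /doubles sE.
  move=> [y xy]; have := arc_regular arc xy n0.
  by case: xy => + _ _ _; rewrite in_itv /= a0 => /andP[x0 ->] xn; rewrite lt_def xn x0.
have [|dl dl0 sdl] := @seq_gt_bound _ s 0; first by move=> x /s01/andP[].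
have [|dr dr1 sdr] := @seq_lt_bound _ s 1; first by move=> x /s01/andP[].
have al : a n.-1 < 1.
  by rewrite -a1 -[in X in _ < X](prednK n0); apply: an; rewrite prednK.
(* [q] lies on the last edge, beyond the first edge and beyond every crossing. *)
pose q := Num.max (a n.-1) (Num.max (a 1%N) dr).
have q1 : q < 1 by rewrite !gt_max al a_first_lt1.
have aq : a 1%N <= q by rewrite !le_max lexx orbT.
have q0 : 0 < q by apply: lt_le_trans aq.
have exposed_cont : continuous exposed.
  apply: continuous_along => T F f x FF fx; apply: cvg_dot; last exact: cvg_cst.
  apply: cvgB; last exact: cvg_cst.
  exact: (cvg_comp _ _ fx (@continuous_trace _ _ _ _ _)).
have [|c cq cmin] := @EVT_min _ exposed (a 1%N) q aq.
  exact: continuous_subspaceT.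
have c0 : 0 < exposed c.
  by apply: exposed_gt0; move: cq; rewrite in_itv /=; have := a_first; lra.
(* [c] minimizes [exposed] on [[a 1], [q]]. The third bound gives [kappa * d / q <= exposed c / 2],
   which is less than [exposed x], and this is at most [exposed x / x] because [x <= 1]. *)
pose d := Num.min (a 1%N / 2) (Num.min dl (exposed c * q / (2 * kappa))).
have d0 : 0 < d.
  rewrite !lt_min dl0 !divr_gt0 ?mulr_gt0 //.
have dle : d <= a 1%N / 2 by rewrite ge_min lexx.
have ddl : d <= dl by rewrite !ge_min lexx orbT.
have dk : d <= exposed c * q / (2 * kappa) by rewrite !ge_min lexx !orbT.
exists s, d, q; split.
- by rewrite -sE.
- move=> x xs; rewrite (le_lt_trans ddl) ?sdl //= (lt_le_trans (sdr _ xs)) //.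
  by rewrite !le_max lexx !orbT.
- split => //; last by rewrite le_max lexx.
  by have := a_first; lra.
- move=> x xa; have x0 : 0 < x by have := a_first; lra.
  have cx : exposed c <= exposed x by apply: cmin; rewrite in_itv.
  rewrite ltr_pdivrMr //.
  have kd : 2 * (kappa * d) <= exposed c * q.
    by move: dk; rewrite ler_pdivlMr ?mulr_gt0 //; lra.
  rewrite mulrAC ltr_pdivlMr //.
  have x1 : x <= 1 by lra.
  have : 0 < kappa * d by rewrite mulr_gt0.
  have : exposed c * q <= exposed x * q by rewrite ler_pM2r.
  by move=> *; nra.
Qed.

(** Squeezes the given heights into the range left to the middle part: with [M] a bound for [h], the
    scaled heights vary by at most 1/4 around 1/4. The summand 1 in [M] keeps it positive. *)
Let height_scale : exists2 eta, 0 < eta &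
  forall x, x \in `[0, 1] -> 0 <= eta * h x + 1 / 4 <= 1 / 2.
Proof.
have [c cI cM] := EVT_max ler01 (arc_height arc).
have [b bI bM] := EVT_min ler01 (arc_height arc).
pose M := `|h c| + `|h b| + 1.
have M0 : 0 < M by rewrite ltr_wpDl // addr_ge0.
exists (4 * M)^-1; first by rewrite invr_gt0 mulr_gt0.
move=> x xI; have hx : - M <= h x <= M.
  have := cM x xI; have := bM x xI; have := ler_norm (h c); have := ler_norm (- h b).
  have := normr_ge0 (h c); have := normr_ge0 (h b); rewrite normrN /M.
  by move=> *; apply/andP; split; lra.
have mM : (4 * M)^-1 * M = 1 / 4 by field; rewrite gt_eqF.
have m0 : 0 < (4 * M)^-1 by rewrite invr_gt0 mulr_gt0.
by move: (4 * M)^-1 mM m0 => m *; apply/andP; split; nra.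
Qed.

Lemma fold_knot : exists l : R -> 'rV[R]_2,
  [/\ pl_simple_loop l, forall t, t \in `[0, 1] -> unit_square R (l t),
      {in `[0, 1[ &, injective (fold a e V n \o l)} &
      ambient_isotopic [set point (g x) (h x) | x in `[0, 1]]
        ((fold a e V n \o l) @` `[0, 1])].
Proof.
have [s [d [q [sE sdq [d0 da aq alq q1] dq_steep]]]] := exists_cut.
have [eta eta0 eta_h] := height_scale.
have mem_s (x z : R) : x \in `[0, 1[ -> z \in `[0, 1[ -> x != z -> g x = g z -> x \in s.
  by move=> x1 z1 xz gxz; have : doubles x; [exists z; split|rewrite sE].
have q0 : 0 < q by apply: lt_le_trans aq.
have dq : d < q by apply: lt_le_trans aq.
have s01 (x : R) : x \in s -> x \in `[0, 1] by move=> /sdq; rewrite in_itv /=; lra.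
have [N [y [[Np yc yN ys N3] [y1 y2 y3]]]] := @height_profile _ d q s
  (fun x => eta * h x + 1 / 4) d0 dq q1 sdq (fun x xs => eta_h x (s01 x xs)).
(* The abscissa of the loop: it advances with [x] up to [q], then returns linearly to 0 at time
   1. *)
pose xi x := x - (1 - q)^-1 * Num.max (x - q) 0.
have xi1 (x : R) : x <= q -> xi x = x.
  by move=> xq; rewrite /xi max_r ?subr_le0 // mulr0 subr0.
have xi2 (x : R) : q <= x -> xi x = q * (1 - x) / (1 - q).
  by move=> xq; rewrite /xi max_l ?subr_ge0 //; field; rewrite subr_eq0 gt_eqF.
have three (x : R) : 0 <= x <= 1 -> [\/ 0 <= x <= d, d <= x <= q | q <= x <= 1].
  move=> /andP[x0 x1]; have [xd|xd] := leP x d; first by constructor 1; rewrite x0.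
  have [xq|xq] := leP x q; first by constructor 2; rewrite ltW.
  by constructor 3; rewrite ltW.
have y01 (x : R) : 0 <= x <= 1 -> 0 <= y x <= 1.
  move=> /three[xd|xd|xd]; last 2 first.
  - by have := y2 x xd; lra.
  - have q10 : 0 < (2 * (1 - q))^-1 by rewrite invr_gt0; lra.
    have : (1 - x) / (2 * (1 - q)) <= 1 by rewrite ler_pdivrMr; lra.
    have : 0 <= (1 - x) / (2 * (1 - q)) by apply: divr_ge0; lra.
    by rewrite y3 //; lra.
  have : x / (2 * d) <= 1 by rewrite ler_pdivrMr; lra.
  have : 0 <= x / (2 * d) by apply: divr_ge0; lra.
  by rewrite y1 //; lra.
have xi01 (x : R) : 0 <= x <= 1 -> 0 <= xi x <= 1.
  move=> x01; have [xq|xq] := leP x q; first by rewrite xi1.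
  rewrite (xi2 x (ltW xq)); apply/andP; split.
    by apply: divr_ge0; nra.
  by rewrite ler_pdivrMr; nra.
(* The difference is 1/4 at every crossing parameter, and at times 0 and 1 both heights close up; so
   it is constant on the fibres of [g]. *)
have [W Wc WE] : exists2 W : 'rV[R]_2 -> R, continuous W &
    forall x, x \in `[0, 1] -> W (g x) = y x - eta * h x.
  apply: factor_extension; first exact: continuous_trace.
    move=> x; apply: (@cvgB _ R^o); first exact: continuous_subspaceT.
    by apply: cvgM; [exact: cvg_cst|exact: arc_height arc x].
  suff W01 (x z : R) : x \in `[0, 1[ -> z \in `[0, 1[ -> g x = g z ->
      y x - eta * h x = y z - eta * h z.
    have y_0 : y 0 = 1 by rewrite y1 ?mul0r ?subr0 // lexx ltW.
    have y_1 : y 1 = 1 by rewrite y3 ?subrr ?mul0r ?subr0 // lexx ltW.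
    have zero : (0 : R) \in `[0, 1[ by rewrite in_itv /= lexx ltr01.
    have g01 : g 1 = g 0 by rewrite trace0; apply: arc_closed arc.
    have split01 (x : R) : x \in `[0, 1] -> (x \in `[0, 1[) \/ (x = 1).
      rewrite !in_itv /= => /andP[-> x1]; have [->|xn] := eqVneq x 1; first by right.
      by left; rewrite lt_neqAle xn.
    move=> x z /split01[x1|->] /split01[z1|->] //; first exact: W01.
      by rewrite g01 => /(W01 _ _ x1 zero) ->; rewrite y_0 y_1 (arc_height_closed arc).
    by rewrite g01 => /(W01 _ _ zero z1) <-; rewrite y_0 y_1 (arc_height_closed arc).
  have [-> //|xz] := eqVneq x z => x1 z1 gxz.
  have xs := mem_s x z x1 z1 xz gxz.
  have zs : z \in s by apply: (mem_s z x) => //; rewrite eq_sym.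
  by rewrite !ys //; ring.
pose C := - V.
(* Clamping to [[a 1], [q]] avoids dividing by 0 at [V], where the first edge has the constant
   direction [e 0] anyway, and freezes [rho] beyond [q], so that the level map becomes the identity
   below height 1/2. *)
pose m x := Num.max (a 1%N) (Num.min x q).
pose rho x := (m x)^-1 *: (g (m x) - V).
have m_itv x : a 1%N <= m x <= q.
  by rewrite /m le_max lexx /= ge_max aq ge_min lexx orbT.
have m_gt0 x : 0 < m x by apply: lt_le_trans a_first _; have /andP[] := m_itv x.
have rhoC x : dot (rho x) C = exposed (m x) / m x by rewrite dotZl mulrC.
have steep x : kappa * d / q < dot (rho x) C by rewrite rhoC; apply: dq_steep.
have [D D0 DE] : exists2 D, 0 < D & D = dot (rho q) C - kappa * d / q.
  by exists (dot (rho q) C - kappa * d / q) => //; rewrite subr_gt0; apply: steep.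
(* At height [z] between 1/2 and 1, the return strand is over abscissa [t z] and the initial strand
   over [t z * d / q]. The line where the functional equals [k z] passes through the latter and is
   fixed; on the last edge, the functional exceeds [k z] by [t z * D], whence the factor [D^-1] in
   [w]. *)
pose t z := 2 * q * (1 - z).
pose k z := dot (V + (t z * d / q) *: e 0%N) C.
pose w z := D^-1 *: (rho (t z) - rho q).
(* The determinant of the level map is the ratio of the gaps between return and initial strand after
   and before the map. *)
have wC z : 1 + dot (w z) C = (dot (rho (t z)) C - kappa * d / q) / D.
  rewrite -[1](divff (lt0r_neq0 D0)) dotZl dotBl [D^-1 * _]mulrC -mulrDl.
  by rewrite {1}DE; congr (_ / _); ring.
have wC0 z : 0 < 1 + dot (w z) C.
  by rewrite wC; apply: divr_gt0 D0; rewrite subr_gt0; apply: steep.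
(* At height y = 1 - x / (2 * q) the return strand of the folded loop is over
   g x = V + x *: rho x, and Psi sends V + x *: rho q, on the last edge, to it. *)
pose Psi v := point (base v + (dot (base v) C - k (height v)) *: w (height v)) (height v).
have rho_first (x : R) : 0 <= x <= a 1%N -> g x = V + x *: rho x.
  move=> xa; have mx : m x = a 1%N.
    by rewrite /m max_l // ge_min; apply/orP; left; case/andP: xa.
  have gm : g (m x) - V = a 1%N *: e 0%N.
    by rewrite mx trace_first ?lexx ?ltW // addrC addKr.
  by rewrite /rho gm mx [_^-1 *: _]scalerA mulVf ?lt0r_neq0 // scale1r trace_first.
have rho_mid (x : R) : a 1%N <= x <= q -> g x = V + x *: rho x.
  move=> /andP[ax xq]; have mx : m x = x by rewrite /m min_l // max_r.
  have x0 : x != 0 by rewrite gt_eqF // (lt_le_trans a_first).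
  by rewrite /rho mx scalerA (mulfV x0) scale1r addrC subrK.
have rhoE (x : R) : 0 <= x <= q -> g x = V + x *: rho x.
  move=> /andP[x0 xq]; have [xa|/ltW ax] := leP x (a 1%N).
    by apply: rho_first; rewrite x0.
  by apply: rho_mid; rewrite ax.
have PsiE (x : R) : 0 <= x <= 1 -> Psi (point (g x) (y x)) = fold a e V n (vec (xi x) (y x)).
  move=> x01; rewrite /Psi base_point height_point fold_trace vec0 vec1 -/g; congr point.
  (* The three parts of the loop: on the initial strand the functional equals [k], on the middle
     part [w] vanishes, and on the last edge the displacement is [x' *: (rho x' - rho q)]. *)
  case: (three x x01) => [xd|xd|xd].
  - rewrite xi1; last by lra.
    have tx : t (y x) * d / q = x by rewrite /t y1 //; field; rewrite !gt_eqF.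
    rewrite /k tx trace_first; last by lra.
    by rewrite subrr scale0r addr0.
  - rewrite xi1; last by case/andP: xd.
    have tq : q <= t (y x) by rewrite /t; have := y2 x xd; nra.
    have mq : m (t (y x)) = m q by rewrite /m !min_r.
    by rewrite /w /rho mq subrr scaler0 scaler0 addr0.
  - set x' := xi x; have x'E : x' = q * (1 - x) / (1 - q) by rewrite /x' xi2; case/andP: xd.
    have tx : t (y x) = x' by rewrite /t y3 // x'E; field; rewrite subr_eq0 gt_eqF.
    have x'q : 0 <= x' <= q.
      rewrite x'E; apply/andP; split; first by apply: divr_ge0; nra.
      by rewrite ler_pdivrMr; nra.
    have rhoq : q *: rho q = - (1 - q) *: e n.-1.
      have := rho_mid q; rewrite aq lexx => /(_ isT); rewrite trace_last ?alq ?ltW //.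
      by move=> /addrI <-; rewrite scaleNr.
    have gx : g x = V + x' *: rho q.
      rewrite trace_last; last by apply/andP; split; lra.
      congr (_ + _); rewrite x'E -mulrA mulrC -scalerA rhoq scalerA -scaleNr; congr (_ *: _).
      by field; rewrite subr_eq0 gt_eqF.
    have -> : dot (g x) C - k (y x) = x' * D.
      rewrite gx /k tx !dotDl (dotZl x' (rho q)) (dotZl _ (e 0%N)) -[dot (e 0%N) C]/kappa DE.
      by move: (dot (rho q) C) => r; ring.
    rewrite (rhoE x' x'q) gx /w tx; exact: slide (lt0r_neq0 D0).
exists (fun x => vec (xi x) (y x)).
have FlE (x : R) : 0 <= x <= 1 -> (fold a e V n \o (fun x => vec (xi x) (y x))) x =
    Psi (point (g x) (y x)) by move=> x01; rewrite PsiE.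
(* Each level map is injective, so a coincidence comes from one of [(g, y)]. It would be a crossing,
   where equal [y] means equal [h], against [arc_simple]. *)
have Fl_inj : {in `[0, 1[ &, injective (fold a e V n \o (fun x => vec (xi x) (y x)))}.
  move=> x z x1 z1; have x01 : 0 <= x <= 1 by move: x1; rewrite in_itv /=; lra.
  have z01 : 0 <= z <= 1 by move: z1; rewrite in_itv /=; lra.
  rewrite !FlE // /Psi !base_point !height_point => /point_inj[+ yxz].
  rewrite yxz => /(level_map_inj (wC0 _)) gxz.
  have [//|xz] := eqVneq x z.
  have xs := mem_s x z x1 z1 xz gxz.
  have zs : z \in s by apply: (mem_s z x) => //; rewrite eq_sym.
  apply: (arc_simple arc x1 z1 gxz); move: yxz; rewrite !ys // => /addIr.
  by apply: mulfI; rewrite gt_eqF.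
split => //.
- split; last first.
    exists N; split => // i iN; have [u [v uv]] := yN i iN.
    have lin (b c : R) : (forall x, x \in `[nth 0 (0 :: N) i, nth 0 N i] -> xi x = b + x * c) ->
        exists u v : 'rV[R]_2, forall x, x \in `[nth 0 (0 :: N) i, nth 0 N i] ->
        vec (xi x) (y x) = u + x *: v.
      move=> bc; exists (vec b u), (vec c v) => x xN.
      by rewrite bc // uv //; apply: vec_eq; rewrite !mxE.
    have le1 : nth 0 N i <= q \/ q <= nth 0 (0 :: N) i.
      by case: (N3 i iN) => [?|[]|?]; [left; lra|left|right].
    case: le1 => iq.
      apply: (lin 0 1) => x; rewrite in_itv /= => /andP[_ xi_le].
      by rewrite xi1 ?(le_trans xi_le) // add0r mulr1.
    apply: (lin (q / (1 - q)) (- (q / (1 - q)))) => x; rewrite in_itv /= => /andP[xi_ge _].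
    by rewrite xi2 ?(le_trans iq) //; ring.
  split.
  + apply: continuous_subspaceT.
    apply: continuous_along => T F f x FF fx; apply: cvg_vec; last exact: (cvg_comp _ _ fx (yc _)).
    apply: (@cvgB _ R^o) => //; apply: cvgM; first exact: cvg_cst.
    have fq : (fun r => f r - q) @ F --> x - q by apply: (@cvgB _ R^o) => //; exact: cvg_cst.
    apply: (cvg_comp _ (fun z => Num.max z 0) fq).
    by apply: (@continuous_max R R^o id (fun=> 0)); [exact: cvg_id|exact: cvg_cst].
  + rewrite xi1 ?ltW // xi2 ?ltW // subrr mulr0 mul0r y1 ?lexx ?ltW // y3 ?lexx ?ltW //.
    by rewrite subrr !mul0r.
  + by move=> x z x1 z1 lxz; apply: Fl_inj => //=; rewrite lxz.
- move=> x; rewrite in_itv /= => x01 j; rewrite mxE in_itv /=.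
  by case: ifP => _; [apply: xi01|apply: y01].
apply: ambient_isotopic_trans (vertical_isotopy _ ltr01 eta0 Wc) _.
pose K := [set point (g x) (y x) | x in `[0, 1]].
have -> : [set point (1 *: base v) (eta * height v + W (base v)) |
    v in [set point (g x) (h x) | x in `[0, 1]]] = K.
  rewrite image_comp; apply: eq_imagel => x x01 /=.
  by rewrite base_point height_point scale1r WE // addrC subrK.
have -> : (fold a e V n \o (fun x => vec (xi x) (y x))) @` `[0, 1] = Psi @` K.
  by rewrite image_comp; apply: eq_imagel => x; rewrite /= in_itv /= => x01; apply: FlE.
apply: (level_isotopy K _ _ wC0).
  apply: continuous_along => T F f x FF fx; apply: cvg_dot; last exact: cvg_cst.
  apply: cvgD; first exact: cvg_cst.
  apply: cvgZ; last exact: cvg_cst.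
  apply: cvgM; last exact: cvg_cst.
  apply: cvgM; last exact: cvg_cst.
  apply: cvgM; first exact: cvg_cst.
  by apply: (@cvgB _ R^o) => //; exact: cvg_cst.
apply: continuous_along => T F f x FF fx; apply: cvgZ; first exact: cvg_cst.
apply: cvgB; last exact: cvg_cst.
have tx : t (f r) @[r --> F] --> t x.
  apply: cvgM; first exact: cvg_cst.
  by apply: (@cvgB _ R^o) => //; exact: cvg_cst.
have mx : m (t (f r)) @[r --> F] --> m (t x).
  apply: (cvg_comp _ m tx).
  apply: (@continuous_max R R^o (fun=> a 1%N) (fun x => Num.min x q)).
    exact: cvg_cst.
  by apply: (@continuous_min R R^o id (fun=> q)); [exact: cvg_id|exact: cvg_cst].
apply: cvgZ; first by apply: cvgV => //; rewrite gt_eqF.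
apply: cvgB; last exact: cvg_cst.
exact: (cvg_comp _ _ mx (@continuous_trace _ _ _ _ _)).
Qed.

Lemma arc_diagram_fold : exists F (G : straight_graph R) (L : set 'rV[R]_3),
  [/\ origami_folding F, crease_pattern F G, (size (edges G) <= n)%N, admits F L &
      ambient_isotopic [set point (g x) (h x) | x in `[0, 1]] L].
Proof.
have [l [lpl lsq linj liso]] := fold_knot.
exists (fold a e V n), (crease_graph e n0 an), ((fold a e V n \o l) @` `[0, 1]).
split => //.
- exact: fold_origami n0 a0 a1 an (arc_unit arc).
- exact: fold_crease_pattern.
- exact: size_crease_graph.
- by exists l.
Qed.

End Loop.
End FoldKnot.

(** * Arc length parametrization of a diagram *)

Section ArcLengthParameter.
Context {R : realType}.

Lemma enorm_gt0 n (v : 'rV[R]_n) : v != 0 -> 0 < enorm v.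
Proof. by move=> v0; rewrite enorm_dot sqrtr_gt0 dot_gt0. Qed.

Lemma enorm_unit n (v : 'rV[R]_n) : v != 0 ->
  dot ((enorm v)^-1 *: v) ((enorm v)^-1 *: v) = 1.
Proof.
move=> v0; rewrite dotZl dotZr mulrA -invfM -expr2 enorm_dot sqr_sqrtr ?dot_ge0 //.
by rewrite mulVf // gt_eqF // dot_gt0.
Qed.

(** The slopes are the ratios of increments, so knots go to knots: an increasing piecewise linear
    change of parameter. *)
Lemma pl_map n (a b m : nat -> R) : (0 < n)%N -> a 0%N = 0 -> b 0%N = 0 ->
  increasing_upto n a -> increasing_upto n b ->
  (forall i, (i < n)%N -> b i.+1 - b i = (a i.+1 - a i) * m i) ->
  forall i x, (i < n)%N -> a i <= x <= a i.+1 ->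
  let y := pl a (m : nat -> R^o) n x in y = b i + (x - a i) * m i /\ b i <= y <= b i.+1.
Proof.
move=> n0 a0 b0 an bn bm i x ni xi.
have knot k : (k <= n)%N -> pl a (m : nat -> R^o) n (a k) = b k.
  move=> kn; rewrite pl_knot //.
  under eq_bigr => j _ do rewrite -[_ *: _]/(_ * _) -bm ?(leq_trans (ltn_ord j)) //.
  by rewrite -(big_mkord xpredT (fun j => b j.+1 - b j)) telescope_sumr // b0 subr0.
have yE : pl a (m : nat -> R^o) n x = b i + (x - a i) * m i.
  by rewrite (pl_piece _ an ni xi) knot // ltnW.
have ai := an i ni; have bi := bn i ni; have bmi := bm i ni.
have mi : 0 < m i by rewrite -(@pmulr_rgt0 _ (a i.+1 - a i)) -?bmi subr_gt0.
by rewrite /= yE; split => //; move: xi => /andP[? ?]; apply/andP; split; nra.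
Qed.

(** The roles of [a] and [b] can be exchanged by inverting the slopes, so the inverse is of the same
    kind. *)
Lemma pl_map_inverse n (a b m : nat -> R) : (0 < n)%N -> a 0%N = 0 -> b 0%N = 0 ->
  increasing_upto n a -> increasing_upto n b ->
  (forall i, (i < n)%N -> b i.+1 - b i = (a i.+1 - a i) * m i) ->
  forall x, 0 <= x <= a n ->
  let y := pl a (m : nat -> R^o) n x in
  0 <= y <= b n /\ pl b (fun i => (m i)^-1 : R^o) n y = x.
Proof.
move=> n0 a0 b0 an bn bm x xn; rewrite /=.
have [|i ni xi] := @locate_piece _ n a x n0; first by rewrite a0.
have [] := pl_map n0 a0 b0 an bn bm ni xi; set y := pl _ _ _ _ => yE yi.
have m0 j : (j < n)%N -> m j != 0.
  move=> jn; apply: contra_neq (lt0r_neq0 (_ : 0 < b j.+1 - b j)); last by rewrite subr_gt0 bn.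
  by move=> mj; rewrite bm // mj mulr0.
have am j : (j < n)%N -> a j.+1 - a j = (b j.+1 - b j) * (m j)^-1.
  by move=> jn; rewrite bm // mulfK // m0.
have [xE _] := pl_map n0 b0 a0 bn an am ni yi; split.
  have bi0 : b 0%N <= b i by apply: increasing_upto_le bn _; rewrite leq0n ltnW.
  have bin : b i.+1 <= b n by apply: increasing_upto_le bn _; rewrite ni leqnn.
  by move: yi; rewrite -b0 => /andP[? ?]; rewrite (le_trans bi0) //= (le_trans _ bin).
by rewrite xE yE addrAC subrr add0r mulfK ?m0 // addrC subrK.
Qed.

(** The factor [mu] scales the total length to 1, so that the arc length parameter fills the width
    of the square. [f] goes from arc length to the old parameter, [g] back. *)
Lemma arclength_parameter n (s : nat -> R) (d : R -> 'rV[R]_2) (u v : nat -> 'rV[R]_2) :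
  (0 < n)%N -> increasing_upto n s ->
  (forall i t, (i < n)%N -> s i <= t <= s i.+1 -> d t = u i + t *: v i) ->
  (forall i, (i < n)%N -> v i != 0) ->
  exists mu a e (f g : R -> R),
    [/\ 0 < mu, a 0%N = 0, a n = 1, increasing_upto n a &
      forall i, (i < n)%N -> dot (e i) (e i) = 1 :> R] /\
    [/\ continuous f,
      forall x, 0 <= x <= 1 -> s 0%N <= f x <= s n /\ g (f x) = x,
      forall t, s 0%N <= t <= s n -> 0 <= g t <= 1 /\ f (g t) = t,
      forall i, (i <= n)%N -> f (a i) = s i &
      forall x, 0 <= x <= 1 -> trace a e (mu *: d (s 0%N)) n x = mu *: d (f x)].
Proof.
move=> n0 sn duv v0.
pose len k := \sum_(i < k) (s i.+1 - s i) * enorm (v i).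
have len_S k : len k.+1 - len k = (s k.+1 - s k) * enorm (v k).
  by rewrite /len big_ord_recr /= addrAC subrr add0r.
have len_lt k : (k < n)%N -> len k < len k.+1.
  move=> kn; rewrite -subr_gt0 len_S mulr_gt0 ?subr_gt0 ?sn //.
  by apply: enorm_gt0; apply: v0.
have len0 : len 0%N = 0 by rewrite /len big_ord0.
have len_gt0 : 0 < len n by rewrite -len0; apply: (increasing_upto_lt len_lt); rewrite n0 leqnn.
pose mu := (len n)^-1; have mu0 : 0 < mu by rewrite invr_gt0.
pose a k := mu * len k.
pose b k := s k - s 0%N.
(* The inverse of the speed of the rescaled curve on the k-th piece. *)
pose m k := (mu * enorm (v k))^-1.
pose e k := (enorm (v k))^-1 *: v k.
have a0 : a 0%N = 0 by rewrite /a len0 mulr0.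
have a1 : a n = 1 by rewrite /a mulVf // gt_eqF.
have an : increasing_upto n a by move=> k kn; rewrite ltr_pM2l // len_lt.
have b0 : b 0%N = 0 by rewrite /b subrr.
have bn : increasing_upto n b by move=> k kn; rewrite ltrD2r sn.
have en0 i : (i < n)%N -> enorm (v i) != 0.
  by move=> ni; rewrite gt_eqF // enorm_gt0 // v0.
have bm i : (i < n)%N -> b i.+1 - b i = (a i.+1 - a i) * m i.
  move=> ni; rewrite /a -mulrBr len_S /b /m opprB addrA subrK.
  by field; rewrite en0 //= gt_eqF.
have am i : (i < n)%N -> a i.+1 - a i = (b i.+1 - b i) * (mu * enorm (v i)).
  by move=> ni; rewrite /a -mulrBr len_S /b opprB addrA subrK mulrCA.
pose f x := s 0%N + pl a (m : nat -> R^o) n x.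
pose g t := pl b (fun i => mu * enorm (v i) : R^o) n (t - s 0%N).
have fg : (fun i => (m i)^-1 : R^o) = (fun i => mu * enorm (v i)).
  by apply/funext => i; rewrite /m invrK.
have fE i x : (i < n)%N -> a i <= x <= a i.+1 ->
    f x = s i + (x - a i) * m i /\ s i <= f x <= s i.+1.
  move=> ni xi; have [yE yi] := pl_map n0 a0 b0 an bn bm ni xi.
  rewrite /f; split; first by rewrite yE /b; ring.
  by move: yi; rewrite /b => /andP[? ?]; apply/andP; split; lra.
have fa i : (i <= n)%N -> f (a i) = s i.
  have [->|i0] := posnP i; first by rewrite /f a0 pl0 // addr0.
  rewrite -(prednK i0) => i1n; have [|-> _] := fE i.-1 (a i.-1.+1) i1n.
    by rewrite lexx andbT ltW // an.
  by rewrite -bm // /b; ring.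
have step i x : (i < n)%N -> a i <= x <= a i.+1 ->
    (x - a i) *: e i = mu *: d (f x) - mu *: d (s i).
  move=> ni xi; have [fx fxi] := fE i x ni xi; have si := ltW (sn _ ni).
  rewrite !(duv i) ?lexx // -scalerBr opprD addrACA subrr add0r -scalerBl fx.
  rewrite addrAC subrr add0r /e /m !scalerA; congr (_ *: _).
  by field; rewrite en0 //= gt_eqF.
exists mu, a, e, f, g; split; split => //.
- by move=> i ni; apply: enorm_unit; apply: v0.
- by apply: continuous_along => T F k x FF kx; apply: (@cvgD _ R^o); [exact: cvg_cst|exact: cvg_pl].
- move=> x x01; have [|y01 gE] := pl_map_inverse n0 a0 b0 an bn bm (x := x); first by rewrite a1.
  split; first by move: y01; rewrite /f /b; lra.
  by rewrite /g /f addrC addKr -fg.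
- move=> t ts; have [|y01 gE] := pl_map_inverse n0 b0 a0 bn an am (x := t - s 0%N).
    by rewrite /b; lra.
  split; first by rewrite -a1.
  have {}gE : pl a (m : nat -> R^o) n (g t) = t - s 0%N by exact gE.
  by rewrite /f gE addrC subrK.
- move=> x x01; have [|i ni xi] := @locate_piece _ n a x n0; first by rewrite a0 a1.
  have knot k : (k <= n)%N -> mu *: d (s 0%N) + pl a e n (a k) = mu *: d (s k).
    elim: k => [_|k IH kn]; first by rewrite a0 pl0 // addr0.
    have ak : a k <= a k.+1 <= a k.+1 by rewrite lexx ltW // an.
    rewrite (pl_piece _ an kn ak) addrA IH 1?ltnW // (step _ _ kn ak) fa //.
    by rewrite addrC subrK.
  rewrite /trace (pl_piece _ an ni xi) addrA knot 1?ltnW // (step _ _ ni xi).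
  by rewrite addrC subrK.
Qed.

End ArcLengthParameter.

(** * Points of largest norm on a polygon *)

Section Exposed.
Context {R : realType}.

(** Convexity of the squared norm: the chord exceeds it by [l * (1 - l)] times the squared length of
    [q - p]. *)
Lemma dot_segment_le n (p q : 'rV[R]_n) l M : 0 <= l <= 1 ->
  dot p p <= M -> dot q q <= M -> dot (p + l *: (q - p)) (p + l *: (q - p)) <= M.
Proof.
move=> /andP[l0 l1] pM qM; have := dot_ge0 (q - p).
rewrite !(dotDl, dotDr, dotNl, dotNr, dotZl, dotZr) (dotC q p).
move: (dot p p) (dot q q) (dot p q) pM qM => P Q X pM qM pq.
have : 0 <= (1 - l) * (M - P) by rewrite mulr_ge0 ?subr_ge0.
have : 0 <= l * (M - Q) by rewrite mulr_ge0 ?subr_ge0.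
have : 0 <= l * (1 - l) * (Q - X + (- X - - P)) by rewrite !mulr_ge0 ?subr_ge0 //; lra.
by move: pq; lra.
Qed.

(** Twice the right-hand side is the difference of the squared norms of [V] and [p] plus the squared
    norm of [V - p]. *)
Lemma dot_exposed n (V p : 'rV[R]_n) : dot p p <= dot V V -> p != V ->
  0 < dot V (V - p).
Proof.
move=> pV; rewrite eq_sym -subr_eq0 => /dot_gt0.
rewrite !(dotBl, dotBr) (dotC p V); lra.
Qed.

Lemma continuous_clamp (T : topologicalType) (f : R -> T) :
  {within `[0, 1], continuous f} -> continuous (fun x => f (clamp x)).
Proof.
move=> /subspace_continuousP fc x.
have cx := clamp_itv x; apply: (cvg_comp clamp f _ (fc _ cx)).
move=> U; rewrite /within /= => nU.
have : nbhs x (clamp @^-1` [set y | y \in `[0, 1] -> U y]).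
  by apply: (@cvg_clamp _ _ (nbhs x) id x _ cvg_id).
apply: (@filterS _ (nbhs x)) => y /= Uy; apply: Uy; exact: clamp_itv.
Qed.

End Exposed.

Lemma ltn_addn_subn n i j : (i < n)%N -> (j < n)%N -> (i + j - n < n)%N.
Proof. lia. Qed.

(** * Reparametrization of a diagram from its farthest vertex *)

Section Diagram.
Context {R : realType}.
Variables (n : nat) (D : pl_diagram R n) (s : seq R) (c : R -> 'rV[R]_3) (h : R -> R).
Let d := curve D.
Hypotheses (sn : size s = n) (sd : affine_along s d).
Hypothesis s_regular : forall t u, double_point d t u -> t \notin 0 :: s.
Hypothesis c_simple : simple_loop c.
Hypothesis c_lift : forall t, t \in `[0, 1] -> c t = point (d t) (h t).

Let S := nth 0 (0 :: s).
Let S_incr : increasing_upto n S.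
Proof. by rewrite -sn; apply: itv_partition_nthS; case: sd. Qed.
Let S0 : S 0%N = 0. Proof. by []. Qed.
Let S1 : S n = 1.
Proof. by rewrite -sn; apply: itv_partition_last; case: sd. Qed.

Let n0 : (0 < n)%N.
Proof. by rewrite -sn; apply: itv_partition_size_gt0; case: sd. Qed.

Let S_le i : (i <= n)%N -> 0 <= S i <= 1.
Proof. by rewrite -sn; apply: itv_partition_itv; case: sd. Qed.

Let in01 (t : R) : 0 <= t < 1 -> t \in `[0, 1].
Proof. by rewrite in_itv /= => /andP[-> /ltW]. Qed.

Lemma height_lift t : t \in `[0, 1] -> h t = height (c t).
Proof. by move=> t01; rewrite c_lift // height_point. Qed.

Let zero01 : (0 : R) \in `[0, 1]. Proof. by rewrite in_itv /= lexx ler01. Qed.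
Let one01 : (1 : R) \in `[0, 1]. Proof. by rewrite in_itv /= lexx ler01. Qed.

Let h_cont : {within `[0, 1], continuous h}.
Proof.
have [cc _ _] := c_simple.
apply: (@subspace_eq_continuous _ _ _ (height \o c)).
  by move=> t; rewrite inE => t01; apply/esym/height_lift.
by move=> t; apply: cvg_height (cc t).
Qed.

Let h_closed : h 0 = h 1.
Proof. by have [_ c01 _] := c_simple; rewrite (height_lift zero01) (height_lift one01) c01. Qed.

Let d_simple x y : 0 <= x < 1 -> 0 <= y < 1 -> d x = d y -> h x = h y -> x = y.
Proof.
have [_ _ cinj] := c_simple => x01 y01 dxy hxy.
by apply: cinj; rewrite ?in_itv //= !c_lift ?dxy ?hxy //; apply: in01.
Qed.

Let pieces : exists u v : nat -> 'rV[R]_2, forall i t, (i < n)%N ->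
  S i <= t <= S i.+1 -> d t = u i + t *: v i.
Proof. by rewrite -sn; apply: affine_along_pieces. Qed.

(** A constant piece would be a point of multiplicity at least three, as the parameters at 1/2, 1/3
    and 1/4 of the piece show. *)
Let v_neq0 u v i : (forall i t, (i < n)%N -> S i <= t <= S i.+1 -> d t = u i + t *: v i) ->
  (i < n)%N -> v i != 0 :> 'rV[R]_2.
Proof.
move=> duv ni; apply/eqP => vi0; have Si := S_incr ni.
have /andP[Si0 _] := S_le (ltnW ni); have /andP[_ Si1] := S_le ni.
pose t k : R := S i + (S i.+1 - S i) / k.
have t01 k : 1 < k -> [/\ t k \in `[0, 1[, d (t k) = u i & S i < t k < S i.+1].
  move=> k1; have k0 : 0 < k by lra.
  have : (S i.+1 - S i) / k * k = S i.+1 - S i by rewrite divfK // gt_eqF.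
  have : 0 < (S i.+1 - S i) / k by rewrite divr_gt0 ?subr_gt0.
  rewrite /t; set x := _ / k => x0 xk; have xS : x < S i.+1 - S i by nra.
  have ti : S i < S i + x < S i.+1 by apply/andP; split; lra.
  split => //; first by rewrite in_itv /=; apply/andP; split; lra.
  by rewrite (duv i) ?vi0 ?scaler0 ?addr0 //; apply/andP; split; lra.
have t_inj k l : 1 < k -> 1 < l -> t k = t l -> k = l.
  move=> k1 l1 /addrI /mulfI -/(_ _)/invr_inj; apply.
  by rewrite subr_eq0 gt_eqF.
have [t2 d2 _] := t01 2 ltac:(lra); have [t3 d3 _] := t01 3 ltac:(lra).
have [t4 d4 _] := t01 4 ltac:(lra).
have dbl k l : 1 < k -> 1 < l -> k != l -> double_point d (t k) (t l).
  move=> k1 l1 kl; have [? dk _] := t01 k k1; have [? dl _] := t01 l l1.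
  by split; rewrite ?dk ?dl //; apply: contra_neq kl => /(t_inj k l k1 l1).
have d23 : double_point d (t 2) (t 3) by apply: dbl; [lra|lra|rewrite lt_eqF //; lra].
have d24 : double_point d (t 2) (t 4) by apply: dbl; [lra|lra|rewrite lt_eqF //; lra].
have := t_inj 3 4 ltac:(lra) ltac:(lra) (curve_no_triple d23 d24); lra.
Qed.

(* The curve runs twice through its period, so that a full period can start at
   any vertex. *)
Let wrap (t : R) := if t < 1 then t else t - 1.
Let dd t := d (wrap t).
Let SS k := if (k < n)%N then S k else S (k - n) + 1.
(** Agrees with [h (wrap t)] on both laps, since the clamped term of the other lap cancels against
    [h 0]; in this form continuity does not have to cross the jump of [wrap]. *)
Let hh t := h (clamp t) + h (clamp (t - 1)) - h 0.

Let hhE t : 0 <= t < 2 -> hh t = h (wrap t).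
Proof.
move=> t02; rewrite /hh /wrap; case: ltP => t1.
  rewrite (clampE (x := t)) ?(@clamp_le0 _ (t - 1)); last by rewrite in_itv /=; lra.
    by ring.
  by lra.
rewrite (@clamp_ge1 _ t) // (clampE (x := t - 1)) -?h_closed; first by ring.
by rewrite in_itv /=; lra.
Qed.

Let hh_cont : continuous hh.
Proof.
have hc := continuous_clamp h_cont.
apply: continuous_along => T F f x FF fx; apply: (@cvgB _ R^o); last exact: cvg_cst.
apply: (@cvgD _ R^o); first exact: (cvg_comp _ _ fx (hc _)).
have f1 : (fun r => f r - 1) @ F --> x - 1 by apply: (@cvgB _ R^o) => //; exact: cvg_cst.
exact: (cvg_comp _ _ f1 (hc _)).
Qed.

Let SS_incr i0 : (i0 < n)%N -> increasing_upto n (fun k => SS (i0 + k)).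
Proof.
move=> i0n k kn; rewrite /SS addnS; case: (ltnP (i0 + k).+1 n) => h1.
  by rewrite (ltnW h1) S_incr // ltnW.
case: (ltnP (i0 + k) n) => h2.
  have -> : (i0 + k).+1 = n by apply/eqP; rewrite eqn_leq h2 h1.
  rewrite subnn S0 add0r -S1; apply: (increasing_upto_lt S_incr).
  by rewrite h2 leqnn.
rewrite ltrD2r subSn // S_incr //.
by lia.
Qed.

Let dd_pieces u v :
  (forall i t, (i < n)%N -> S i <= t <= S i.+1 -> d t = u i + t *: v i) ->
  forall i0, (i0 < n)%N -> exists u' v' : nat -> 'rV[R]_2,
   (forall i t, (i < n)%N -> SS (i0 + i) <= t <= SS (i0 + i.+1) -> dd t = u' i + t *: v' i) /\
   (forall i, (i < n)%N -> exists2 j, (j < n)%N & v' i = v j).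
Proof.
move=> duv i0 i0n.
have d01 : d 1 = d 0 by apply/esym/curve_closed.
(* On the second lap the old parameter is [t - 1], which moves [- v] into the constant term. *)
pose u' i := if (i0 + i < n)%N then u (i0 + i)%N else u (i0 + i - n)%N - v (i0 + i - n)%N.
pose v' i := if (i0 + i < n)%N then v (i0 + i)%N else v (i0 + i - n)%N.
exists u', v'; split; last first.
  move=> i ni; rewrite /v'; case: ltnP => h1; first by exists (i0 + i)%N.
  by exists (i0 + i - n)%N => //; apply: ltn_addn_subn.
move=> i t ni; rewrite /SS addnS /u' /v' /dd /wrap; case: (ltnP (i0 + i) n) => h1 ti.
  have ti' : S (i0 + i) <= t <= S (i0 + i).+1.
    move: ti; case: ltnP => h2 //.
    have -> : (i0 + i).+1 = n by apply/eqP; rewrite eqn_leq h1 h2.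
    by rewrite subnn S0 add0r S1.
  have [t1|t1] := ltP t 1; first exact: duv.
  have tE : t = 1.
    apply/eqP; rewrite eq_le t1 andbT; move: ti' => /andP[_ /le_trans]; apply.
    by have /andP[] := S_le h1.
  by rewrite -(duv _ _ h1 ti') tE subrr d01.
have ti' : S (i0 + i - n) <= t - 1 <= S (i0 + i - n).+1.
  move: ti; rewrite ltnNge (leq_trans h1) //= subSn //.
  by move=> /andP[? ?]; apply/andP; split; lra.
have jn := ltn_addn_subn i0n ni.
have t1 : 1 <= t by move: ti' => /andP[]; have /andP[] := S_le (ltnW jn); lra.
rewrite ltNge t1 /= (duv _ _ jn ti') scalerBl scale1r.
by rewrite [t *: _ - _]addrC addrA.
Qed.

(** By convexity on each piece the squared norm is largest at a breakpoint, and the breakpoint 1 can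
    be replaced by 0 as the curve is closed. *)
Let exists_far u v :
  (forall i t, (i < n)%N -> S i <= t <= S i.+1 -> d t = u i + t *: v i :> 'rV[R]_2) ->
  exists2 i0, (i0 < n)%N & forall t, t \in `[0, 1] -> dot (d t) (d t) <= dot (d (S i0)) (d (S i0)).
Proof.
move=> duv; pose f (i : 'I_n) := dot (d (S i)) (d (S i)).
case: (@arg_maxP _ _ _ (Ordinal n0) xpredT f isT) => i0 _ i0P.
exists i0 => // t; rewrite in_itv /= => t01.
have SM i : (i <= n)%N -> dot (d (S i)) (d (S i)) <= f i0.
  rewrite leq_eqVlt => /orP[/eqP ->|ni]; last exact: (i0P (Ordinal ni)).
  have d01 : d 1 = d 0 by apply/esym/curve_closed.
  by rewrite S1 d01; exact: (i0P (Ordinal n0)).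
have [|i ni ti] := @locate_piece _ n S t n0; first by rewrite S1.
have Si := S_incr ni.
pose l := (t - S i) / (S i.+1 - S i).
have tE : d t = d (S i) + l *: (d (S i.+1) - d (S i)).
  have di : d (S i) = u i + S i *: v i by apply: duv; rewrite ?lexx ?ltW.
  have di1 : d (S i.+1) = u i + S i.+1 *: v i by apply: duv; rewrite ?lexx ?ltW.
  rewrite (duv i t) // di di1 opprD addrACA subrr add0r -scalerBl scalerA.
  rewrite -addrA -scalerDl; congr (_ + _ *: _); rewrite /l; field.
  by rewrite subr_eq0 gt_eqF.
rewrite tE; apply: dot_segment_le; [|exact: SM (ltnW ni)|exact: SM].
by rewrite /l divr_ge0 ?ler_pdivrMr ?subr_gt0 //; move: ti => /andP[? ?]; lra.
Qed.

Lemma diagram_arc : exists a e V g, arc_diagram n a e V g /\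
  ambient_isotopic (c @` `[0, 1]) [set point (trace a e V n x) (g x) | x in `[0, 1]].
Proof.
have [u [v duv]] := pieces; have [i0 i0n far] := exists_far duv.
have [u' [v' [ddP v'v]]] := dd_pieces duv i0n.
have v'0 i : (i < n)%N -> v' i != 0.
  by move=> /v'v[j jn ->]; apply: v_neq0 duv jn.
have [mu [a [e [f [g [[mu0 a0 a1 an e1] [fc fx gt fa trE]]]]]]] :=
  arclength_parameter n0 (SS_incr i0n) ddP v'0.
have t0E : SS (i0 + 0) = S i0 by rewrite addn0 /SS i0n.
have t1E : SS (i0 + n) = S i0 + 1 by rewrite /SS ltnNge leq_addl /= addnK.
have [t0 t0S] : exists t0, t0 = S i0 by exists (S i0).
rewrite t0E t1E -t0S in fx gt; rewrite t0E -t0S in trE; rewrite -t0S in far.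
have t01 : 0 <= t0 < 1.
  rewrite t0S; have /andP[-> _] := S_le (ltnW i0n).
  by rewrite -S1; apply: (increasing_upto_lt S_incr); rewrite i0n leqnn.
have f0 : f 0 = t0 by rewrite -a0 fa // t0E t0S.
have f1 : f 1 = t0 + 1 by have := fa n (leqnn n); rewrite a1 t1E -t0S.
have window (x : R) : 0 <= x < 1 -> t0 <= f x < t0 + 1.
  move=> /andP[x0 x1]; have [|/andP[-> fx1] gf] := fx x; first by rewrite x0 ltW.
  rewrite /= lt_neqAle fx1 andbT -f1; apply/eqP => /(congr1 g).
  rewrite gf; have [|_ ->] := fx 1; first by rewrite ler01 lexx.
  by move=> x1'; rewrite x1' ltxx in x1.
have wrap_itv t : t0 <= t < t0 + 1 -> 0 <= wrap t < 1.
  by rewrite /wrap => /andP[? ?]; case: ltP => ?; apply/andP; split; move: t01 => /andP[? ?]; lra.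
have unwrap t : t0 <= t < t0 + 1 -> (if t0 <= wrap t then wrap t else wrap t + 1) = t.
  rewrite /wrap => /andP[tt0 tt1]; case: ltP => t1; first by rewrite tt0.
  by case: leP => ?; move: t01 => /andP[? ?]; lra.
have wrap_unwrap t : 0 <= t < 1 -> let r := if t0 <= t then t else t + 1 in
    t0 <= r < t0 + 1 /\ wrap r = t.
  move=> /andP[tt0 tt1]; move: t01 => /andP[? ?]; rewrite /wrap /=.
  case: (leP t0 t) => tt; first by rewrite tt1; split => //; apply/andP; split; lra.
  case: (ltP (t + 1) 1) => t1; first by lra.
  by split; [apply/andP; split|]; lra.
have fwrap x : 0 <= x < 1 -> 0 <= wrap (f x) < 1 by move=> /window/wrap_itv.
have fwrap_inj x y : 0 <= x < 1 -> 0 <= y < 1 -> wrap (f x) = wrap (f y) -> x = y.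
  move=> x01 y01 fxy; have fE : f x = f y.
    by rewrite -(unwrap _ (window x x01)) -(unwrap _ (window y y01)) fxy.
  have [|_ <-] := fx x; first by move: x01 => /andP[-> /ltW ->].
  have [|_ gy] := fx y; first by move: y01 => /andP[-> /ltW ->].
  by rewrite fE gy.
have wrap_t0 : wrap t0 = t0 by rewrite /wrap; move: t01 => /andP[_ ->].
have wrap_t1 : wrap (t0 + 1) = t0.
  by rewrite /wrap; case: ltP => ?; move: t01 => /andP[? ?]; lra.
have hhf x : 0 <= x <= 1 -> hh (f x) = h (wrap (f x)).
  move=> x01; apply: hhE; have [/andP[? ?] _] := fx x x01.
  by move: t01 => /andP[? ?]; apply/andP; split; lra.
have dt0 : dd t0 = d t0 by rewrite /dd wrap_t0.
rewrite dt0 in trE; have {}trE x : 0 <= x <= 1 ->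
  trace a e (mu *: d t0) n x = mu *: d (wrap (f x)) by exact: trE.
have mu_neq0 : mu != 0 by rewrite gt_eqF.
have trI x y : 0 <= x < 1 -> 0 <= y < 1 ->
    trace a e (mu *: d t0) n x = trace a e (mu *: d t0) n y -> d (wrap (f x)) = d (wrap (f y)).
  move=> x01 y01; rewrite !trE; last 2 first.
  - by move: y01 => /andP[-> /ltW ->].
  - by move: x01 => /andP[-> /ltW ->].
  by move=> /(scalerI mu_neq0).
have one1 : 0 <= (1 : R) <= 1 by rewrite ler01 lexx.
have zero1 : 0 <= (0 : R) <= 1 by rewrite ler01 lexx.
(* [wrap \o f] is injective on the half-open period, so every double point of the trace comes from
   one of the diagram. *)
have dbl x y : double_point (trace a e (mu *: d t0) n) x y ->
    double_point d (wrap (f x)) (wrap (f y)).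
  case; rewrite !in_itv /= => x01 y01 xy txy.
  split; rewrite ?in_itv //=; [exact: fwrap|exact: fwrap| |exact: trI].
  by apply: contra_neq xy => /(fwrap_inj x y x01 y01).
exists a, e, (mu *: d t0), (fun x => hh (f x)); split; first split => //.
- by rewrite trE // f1 wrap_t1.
- apply: continuous_subspaceT.
  suff hf (x : R) : hh (f t) @[t --> x] --> hh (f x) by exact: hf.
  exact (cvg_comp f hh (fc x) (hh_cont (x := f x))).
- by rewrite !hhf // f0 f1 wrap_t0 wrap_t1.
- move=> x y; rewrite !in_itv /= => x01 y01 txy.
  rewrite !hhf; last 2 first.
  + by move: y01 => /andP[-> /ltW ->].
  + by move: x01 => /andP[-> /ltW ->].
  move=> hxy; apply: fwrap_inj => //.
  by apply: d_simple hxy; [exact: fwrap|exact: fwrap|exact: trI].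
- move=> x y /dbl /s_regular xs i ni; apply: contra xs => /eqP ->.
  have [j jn ->] : exists2 j, (j < n)%N & wrap (f (a i)) = S j.
    rewrite fa 1?ltnW // /SS; case: ltnP => h1.
      exists (i0 + i)%N => //; rewrite /wrap -S1 (increasing_upto_lt S_incr) //.
      by rewrite h1 leqnn.
    have jn := ltn_addn_subn i0n ni; exists (i0 + i - n)%N => //.
    have /andP[S_ge0 _] := S_le (ltnW jn).
    by rewrite /wrap ltNge lerDr S_ge0 /= addrK.
  by apply: mem_nth; rewrite /= sn ltnW.
- apply: (@sub_finite_set _ _ ((fun t => g (if t0 <= t then t else t + 1)) @`
    [set t | exists u, double_point d t u])); last first.
    by apply: finite_image; apply: curve_finite.
  move=> x [y xy]; exists (wrap (f x)); first by exists (wrap (f y)); apply: dbl.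
  have x01 : 0 <= x < 1 by case: xy; rewrite in_itv.
  rewrite unwrap; last exact: window.
  by have [|_] := fx x; first by move: x01 => /andP[-> /ltW ->].
- move=> x /andP[x0 x1]; have x01 : 0 <= x < 1 by rewrite ltW.
  rewrite trE; last by rewrite !ltW.
  rewrite -scalerBr dotZl dotZr !mulr_gt0 //; apply: dot_exposed.
    by apply: far; rewrite in_itv /=; have /andP[-> /ltW ->] := fwrap x x01.
  (* Another parameter mapped to the starting vertex would make that vertex a double point. *)
  apply/eqP => dx; have : double_point d t0 (wrap (f x)).
    split; rewrite ?in_itv //=; first exact: fwrap.
    apply/eqP => tx; move: x0; rewrite -(fwrap_inj 0 x _ x01) ?ltxx // ?lexx ?ltr01 //.
    by rewrite f0 wrap_t0.
  by move=> /s_regular/negP; apply; rewrite t0S; apply: mem_nth; rewrite /= sn ltnW.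
(* The traced curve is the given lift with the plane scaled by [mu] and the heights unchanged. *)
have W0 : continuous (fun _ : 'rV[R]_2 => 0 : R) by exact: cst_continuous.
have := vertical_isotopy (c @` `[0, 1]) mu0 ltr01 W0.
congr ambient_isotopic; rewrite image_comp; apply/seteqP; split => p /=; last first.
  move=> [x]; rewrite in_itv /= => x01 <-; have [/andP[? ?] _] := fx x x01.
  have w01 : wrap (f x) \in `[0, 1].
    rewrite in_itv /= /wrap; move: t01 => /andP[? ?].
    by case: ltP => ?; apply/andP; split; lra.
  exists (wrap (f x)) => //.
  by rewrite c_lift // base_point height_point mul1r addr0 trE // hhf.
move=> [t t_itv <-].
wlog t_01 : t t_itv / 0 <= t < 1 => [IH|].
  have [t1|t1] := ltP t 1; first by apply: IH => //; move: t_itv; rewrite in_itv /= t1 => /andP[->].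
  have -> : t = 1 by apply/eqP; rewrite eq_le t1 andbT; move: t_itv; rewrite in_itv => /andP[].
  have [_ <- _] := c_simple; apply: IH; first exact: zero01.
  by rewrite lexx ltr01.
have [rt wr] := wrap_unwrap t t_01; set r := (if _ then _ else _) in rt wr.
have [|gr fgr] := gt r; first by move: rt => /andP[-> /ltW ->].
exists (g r); first by rewrite in_itv.
by rewrite trE // hhf // fgr wr c_lift // base_point height_point mul1r addr0.
Qed.

End Diagram.

(** * Generic projections of a polygonal knot *)

Section Generic.
Context {R : realType}.

(** All but finitely many parameters, witnessed by a polynomial so that conjunctions become
    products. *)
Definition generic (P : R -> Prop) :=
  exists2 p : {poly R}, p != 0 & forall t, p.[t] != 0 -> P t.

Lemma generic_ex P : generic P -> exists t, P t.
Proof.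
(* A nonzero [p] has fewer than [size p] roots, so one of that many natural numbers is not a
   root. *)
move=> [p p0 pP]; pose s : seq R := [seq i%:R | i <- iota 0 (size p)].
have s_uniq : uniq s.
  by rewrite map_inj_uniq ?iota_uniq // => i j /eqP; rewrite eqr_nat => /eqP.
have /allPn[t _ pt] : ~~ all (root p) s.
  apply/negP => ps; have := max_poly_roots p0 ps s_uniq.
  by rewrite size_map size_iota ltnn.
by exists t; apply: pP.
Qed.

Lemma generic_and P Q : generic P -> generic Q -> generic (fun t => P t /\ Q t).
Proof.
move=> [p p0 pP] [q q0 qQ]; exists (p * q); first by rewrite mulf_neq0.
by move=> t; rewrite hornerM mulf_eq0 negb_or => /andP[/pP ? /qQ ?].
Qed.

Lemma generic_mono (P Q : R -> Prop) : (forall t, P t -> Q t) -> generic P -> generic Q.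
Proof. by move=> PQ [p p0 pP]; exists p => // t /pP/PQ. Qed.

Lemma generic_true (P : R -> Prop) : (forall t, P t) -> generic P.
Proof. by move=> PT; exists 1; rewrite ?oner_neq0. Qed.

Lemma generic_forall n (P : nat -> R -> Prop) :
  (forall i, (i < n)%N -> generic (P i)) -> generic (fun t => forall i, (i < n)%N -> P i t).
Proof.
elim: n => [_|n IH Pn]; first exact: generic_true.
have [|p p0 pP] := IH; first by move=> i ni; apply: Pn; apply: ltnW.
apply: generic_mono (generic_and (ex_intro2 _ _ p p0 pP) (Pn n (ltnSn n))).
move=> t [Pt Pnt] i; rewrite ltnS leq_eqVlt => /orP[/eqP -> //|]; exact: Pt.
Qed.

Lemma generic_seq (s : seq R) :
  generic (fun t => \sum_(i < size s) s`_i * t ^+ i != 0) \/ forall i, s`_i = 0.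
Proof.
have [s0|s0] := eqVneq (Poly s) 0.
  by right=> i; rewrite -coef_Poly s0 coef0.
left; exists (Poly s) => // t; congr (_ != 0).
elim: s {s0} => [|x s IH]; first by rewrite /= horner0 big_ord0.
rewrite /= horner_cons IH big_ord_recl /= expr0 mulr1 addrC; congr (_ + _).
by rewrite mulr_suml; apply: eq_bigr => i _; rewrite exprSr mulrA.
Qed.

End Generic.

(** * Degenerate projections expressed by determinants *)

Section Determinant.
Context {R : realType}.
Implicit Types u v w p q : 'rV[R]_3.

Let X v := base v 0 0.
Let Y v := base v 0 1.
Let Z v := height v.

(** The triple product expanded along [w], the slot that receives the projection direction; the
    coefficients form the cross product of [p] and [q]. *)
Definition det3 p q w :=
  X w * (Y p * Z q - Z p * Y q) + Y w * (Z p * X q - X p * Z q) +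
  Z w * (X p * Y q - Y p * X q).

Let XD u v : X (u + v) = X u + X v. Proof. by rewrite /X /base !mxE. Qed.
Let YD u v : Y (u + v) = Y u + Y v. Proof. by rewrite /Y /base !mxE. Qed.
Let ZD u v : Z (u + v) = Z u + Z v. Proof. by rewrite /Z /height !mxE. Qed.
Let XZ k u : X (k *: u) = k * X u. Proof. by rewrite /X /base !mxE. Qed.
Let YZ k u : Y (k *: u) = k * Y u. Proof. by rewrite /Y /base !mxE. Qed.
Let ZZ k u : Z (k *: u) = k * Z u. Proof. by rewrite /Z /height !mxE. Qed.
Let XN u : X (- u) = - X u. Proof. by rewrite /X /base !mxE. Qed.
Let YN u : Y (- u) = - Y u. Proof. by rewrite /Y /base !mxE. Qed.
Let ZN u : Z (- u) = - Z u. Proof. by rewrite /Z /height !mxE. Qed.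
Let XYZ := (XD, YD, ZD, XZ, YZ, ZZ, XN, YN, ZN).

Let coordE u v : X u = X v -> Y u = Y v -> Z u = Z v -> u = v.
Proof.
move=> eX eY eZ; rewrite -[u]pointK -[v]pointK; congr point => //.
exact: vec_eq.
Qed.

Let coordP x y z : exists w, [/\ X w = x, Y w = y & Z w = z].
Proof.
by exists (point (vec x y) z); rewrite /X /Y /Z base_point height_point vec0 vec1.
Qed.

(** The basis vectors in place of [w] show that the cross product vanishes; a nonzero coordinate of
    [v] then gives the ratio. *)
Lemma det3_parallel p v : v != 0 -> (forall w, det3 p v w = 0) -> exists k, p = k *: v.
Proof.
move=> v0 pv.
have [wx [wx1 wx2 wx3]] := coordP 1 0 0; have [wy [wy1 wy2 wy3]] := coordP 0 1 0.
have [wz [wz1 wz2 wz3]] := coordP 0 0 1.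
have := pv wx; rewrite /det3 wx1 wx2 wx3 !mul1r !mul0r !addr0 => hx.
have := pv wy; rewrite /det3 wy1 wy2 wy3 !mul1r !mul0r addr0 add0r => hy.
have := pv wz; rewrite /det3 wz1 wz2 wz3 !mul1r !mul0r !add0r => hz.
have {hx hy hz} [hx hy hz] : [/\ Y p * Z v = Z p * Y v, Z p * X v = X p * Z v &
  X p * Y v = Y p * X v] by split; apply/subr0_eq.
have [X0|X0] := eqVneq (X v) 0; last first.
  exists (X p / X v); apply: coordE; rewrite XYZ; apply: (mulIf X0);
    by rewrite mulrAC mulfVK //; lra.
have [Y0|Y0] := eqVneq (Y v) 0; last first.
  exists (Y p / Y v); apply: coordE; rewrite XYZ; apply: (mulIf Y0);
    by rewrite mulrAC mulfVK //; lra.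
have [Z0|Z0] := eqVneq (Z v) 0; last first.
  exists (Z p / Z v); apply: coordE; rewrite XYZ; apply: (mulIf Z0);
    by rewrite mulrAC mulfVK //; lra.
case/negP: v0; apply/eqP; rewrite -[0](scale0r 0).
by apply: coordE; rewrite ?XYZ mul0r.
Qed.

(* The monomials of degree at most 2 in t and t ^+ 3 are distinct powers of t, so
   that a nonzero quadratic form restricts to a nonzero polynomial. *)
Definition direction (t : R) := point (vec (- t) (- t ^+ 3)) 1.

Let directionE t : [/\ X (direction t) = - t, Y (direction t) = - t ^+ 3 & Z (direction t) = 1].
Proof. by rewrite /X /Y /Z base_point height_point vec0 vec1. Qed.

Lemma direction_neq0 t : direction t != 0.
Proof.
apply/eqP => /(congr1 Z); have [_ _ ->] := directionE t.
by rewrite -(scale0r 0) XYZ mul0r => /eqP; rewrite oner_eq0.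
Qed.

(** The second alternative covers configurations that are degenerate in space and hence in every
    projection; these are excluded later by geometry. *)
Lemma generic_det3 p q :
  generic (fun t => det3 p q (direction t) != 0 \/ forall w, det3 p q w = 0).
Proof.
pose cx := Y p * Z q - Z p * Y q; pose cy := Z p * X q - X p * Z q.
pose cz := X p * Y q - Y p * X q.
(* Coefficients of 1, [t], [t ^+ 2], [t ^+ 3] in [cz - cx * t - cy * t ^+ 3]. *)
have [gen|all0] := generic_seq [:: cz; - cx; 0; - cy].
  apply: generic_mono gen => t; rewrite !big_ord_recl big_ord0 /= => nz; left.
  apply: contra_neq nz; rewrite /det3; have [-> -> ->] := directionE t.
  rewrite -/cx -/cy -/cz => dE; rewrite -[RHS]dE /bump /=; ring.
apply: generic_true => t; right => w; rewrite /det3 -/cx -/cy -/cz.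
have := all0 0%N; have := all0 1%N; have := all0 3%N => /= /eqP.
by rewrite oppr_eq0 => /eqP -> /eqP; rewrite oppr_eq0 => /eqP -> ->; rewrite !mulr0 !addr0.
Qed.

(** For some [q] the determinant of [v], [q] and the direction is generically nonzero, whereas a
    multiple of [v] along the direction would annihilate it. *)
Lemma generic_not_parallel v : v != 0 ->
  generic (fun t => forall k l, k *: v = l *: direction t -> k = 0).
Proof.
move=> v0.
have [[q qv]|nq] := pselect (exists q, exists w, det3 v q w != 0); last first.
  have vw w : det3 v w =1 fun=> 0.
    move=> q; apply/eqP/negPn/negP => vqw; apply: nq.
    by exists w, q.
  have [wx [wx1 wx2 wx3]] := coordP 1 0 0; have [wy [wy1 wy2 wy3]] := coordP 0 1 0.
  have [wz [wz1 wz2 wz3]] := coordP 0 0 1.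
  case/negP: v0; apply/eqP; rewrite -[0](scale0r 0); apply: coordE; rewrite XYZ mul0r.
  - have := vw wy wz; rewrite /det3 wy1 wy2 wy3 wz1 wz2 wz3; lra.
  - have := vw wz wx; rewrite /det3 wx1 wx2 wx3 wz1 wz2 wz3; lra.
  - have := vw wx wy; rewrite /det3 wy1 wy2 wy3 wx1 wx2 wx3; lra.
apply: generic_mono (generic_det3 v q) => t [nz|all0]; last first.
  by case: qv => w; rewrite all0 eqxx.
move=> k l kl; apply/eqP; apply: contraTT nz => k0; rewrite negbK; apply/eqP.
apply: (mulfI k0); rewrite mulr0.
have -> : k * det3 v q (direction t) = det3 (k *: v) q (direction t).
  by rewrite /det3 !XYZ; ring.
by rewrite kl /det3 !XYZ; ring.
Qed.

(* Vanishes at w when the three lines u i + R v i project along w to concurrent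
   lines. *)
Definition concurrency u1 v1 u2 v2 u3 v3 w :=
  det3 v2 v3 w * det3 u1 v1 w + det3 v3 v1 w * det3 u2 v2 w + det3 v1 v2 w * det3 u3 v3 w.

Lemma generic_concurrency u1 v1 u2 v2 u3 v3 :
  generic (fun t => concurrency u1 v1 u2 v2 u3 v3 (direction t) != 0 \/
    forall w, concurrency u1 v1 u2 v2 u3 v3 w = 0).
Proof.
pose cr p q := (Y p * Z q - Z p * Y q, Z p * X q - X p * Z q, X p * Y q - Y p * X q).
have [f [fE]] : exists f : R * R * R * R * R * R, 
   (forall w, concurrency u1 v1 u2 v2 u3 v3 w =
     f.1.1.1.1.1 * X w ^+ 2 + f.1.1.1.1.2 * Y w ^+ 2 + f.1.1.1.2 * Z w ^+ 2 +
     f.1.1.2 * (X w * Y w) + f.1.2 * (X w * Z w) + f.2 * (Y w * Z w)) /\ True.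
  have prod p q r s : exists f : R * R * R * R * R * R, forall w,
     det3 p q w * det3 r s w =
     f.1.1.1.1.1 * X w ^+ 2 + f.1.1.1.1.2 * Y w ^+ 2 + f.1.1.1.2 * Z w ^+ 2 +
     f.1.1.2 * (X w * Y w) + f.1.2 * (X w * Z w) + f.2 * (Y w * Z w).
    rewrite /det3.
    move: (Y p * Z q - Z p * Y q) (Z p * X q - X p * Z q) (X p * Y q - Y p * X q) => a b c.
    move: (Y r * Z s - Z r * Y s) (Z r * X s - X r * Z s) (X r * Y s - Y r * X s) => d e f.
    exists (a * d, b * e, c * f, a * e + b * d, a * f + c * d, b * f + c * e) => w /=; ring.
  have [f fE] := prod v2 v3 u1 v1; have [g gE] := prod v3 v1 u2 v2.
  have [h hE] := prod v1 v2 u3 v3.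
  exists (f.1.1.1.1.1 + g.1.1.1.1.1 + h.1.1.1.1.1, f.1.1.1.1.2 + g.1.1.1.1.2 + h.1.1.1.1.2,
    f.1.1.1.2 + g.1.1.1.2 + h.1.1.1.2, f.1.1.2 + g.1.1.2 + h.1.1.2,
    f.1.2 + g.1.2 + h.1.2, f.2 + g.2 + h.2); split => // w.
  by rewrite /concurrency fE gE hE /=; ring.
move: f fE => [[[[[a b] c] d] e] f] fE _.
(* Along the curve of directions the squares give [t ^+ 2], [t ^+ 6] and 1, and the mixed terms XY,
   XZ, YZ give [t ^+ 4], [- t] and [- t ^+ 3]. *)
have [gen|all0] := generic_seq [:: c; - e; a; - f; d; 0; b].
  apply: generic_mono gen => t; rewrite !big_ord_recl big_ord0 /= => nz; left.
  apply: contra_neq nz; rewrite fE /=; have [-> -> ->] := directionE t.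
  by move=> dE; rewrite -[RHS]dE /bump /=; ring.
apply: generic_true => t; right => w; rewrite fE /=.
have /= c0 := all0 0%N; have /= e0 := all0 1%N; have /= a0 := all0 2%N.
have /= f0 := all0 3%N; have /= d0 := all0 4%N; have /= b0 := all0 6%N.
by rewrite a0 b0 c0 d0 -[e]opprK e0 -[f]opprK f0; ring.
Qed.

(** The three lines pass through [A], [A + al *: w] and [A + be *: w], which have the same
    projection along [w]. *)
Lemma concurrency_projected w A v1 v2 v3 al be t1 t2 t3 :
  concurrency (A - t1 *: v1) v1 (A + al *: w - t2 *: v2) v2 (A + be *: w - t3 *: v3) v3 w = 0.
Proof. by rewrite /concurrency /det3 !XYZ; ring. Qed.

(* Evaluating at v1 + w leaves only (be - al) det(v1,v2,w) det(v3,v1,w). *)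
Lemma concurrency_zero w A v1 v2 v3 al be t1 t2 t3 :
  (forall w', concurrency (A - t1 *: v1) v1 (A + al *: w - t2 *: v2) v2
    (A + be *: w - t3 *: v3) v3 w' = 0) ->
  det3 v1 v2 w != 0 -> det3 v3 v1 w != 0 -> al = be.
Proof.
move=> /(_ (v1 + w)) c0 d12 d31; apply/eqP; rewrite eq_sym -subr_eq0; apply/eqP.
apply: (mulIf d12); apply: (mulIf d31); rewrite !mul0r -[RHS]c0.
by rewrite /concurrency /det3 !XYZ; ring.
Qed.

Lemma det3_span k l v w : det3 (k *: v + l *: w) v w = 0.
Proof. by rewrite /det3 !XYZ; ring. Qed.

Lemma det3Zl k p q w : det3 (k *: p) q w = k * det3 p q w.
Proof. by rewrite /det3 !XYZ; ring. Qed.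

(** The projection to the horizontal plane along [direction t]. *)
Definition shear t (x : 'rV[R]_3) := base x + height x *: vec t (t ^+ 3).

Lemma shear_eq t (x y : 'rV[R]_3) :
  shear t x = shear t y -> x - y = (height x - height y) *: direction t.
Proof.
have shX z : shear t z 0 0 = X z + Z z * t by rewrite mxE [X in _ + X]mxE vec0.
have shY z : shear t z 0 1 = Y z + Z z * t ^+ 3 by rewrite mxE [X in _ + X]mxE vec1.
move=> xy; have eX := congr1 (fun p : 'rV[R]_2 => p 0 0) xy.
have eY := congr1 (fun p : 'rV[R]_2 => p 0 1) xy; rewrite /= !shX !shY in eX eY.
have [dX dY dZ] := directionE t.
by apply: coordE; rewrite !XYZ ?dX ?dY ?dZ -/(Z x) -/(Z y); lra.
Qed.

End Determinant.

(** * Regular projections of a polygonal knot are diagrams *)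

Section Projection.
Context {R : realType}.
Variables (s : seq R) (c : R -> 'rV[R]_3).
Hypotheses (c_simple : simple_loop c) (sc : affine_along s c).

Let n := size s.
Let S := nth 0 (0 :: s).
Let S_incr : increasing_upto n S.
Proof. by apply: itv_partition_nthS; case: sc. Qed.
Let S0 : S 0%N = 0. Proof. by []. Qed.
Let S1 : S n = 1.
Proof. by apply: itv_partition_last; case: sc. Qed.

Let n0 : (0 < n)%N.
Proof. by apply: itv_partition_size_gt0; case: sc. Qed.

Let S_le i : (i <= n)%N -> 0 <= S i <= 1.
Proof. by apply: itv_partition_itv; case: sc. Qed.

Let c_inj t w : t \in `[0, 1[ -> w \in `[0, 1[ -> c t = c w -> t = w.
Proof. by have [_ _ cinj] := c_simple; apply: cinj. Qed.

Section Pieces.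
Variables u v : nat -> 'rV[R]_3.
Hypothesis cuv : forall i t, (i < n)%N -> S i <= t <= S i.+1 -> c t = u i + t *: v i.

Let v_neq0 i : (i < n)%N -> v i != 0.
Proof.
move=> ni; apply/eqP => vi0; have Si := S_incr ni.
have /andP[Si0 _] := S_le (ltnW ni); have /andP[_ Si1] := S_le ni.
have : S i = (S i + S i.+1) / 2.
  apply: c_inj; rewrite ?in_itv /=; try (apply/andP; split; lra).
  by rewrite !(cuv ni) ?vi0 ?scaler0 //; apply/andP; split; lra.
by lra.
Qed.

(** In order: no segment collapses; no vertex falls on the projected line of a segment; no two
    segments become parallel; no two lines of segments fall together, which matters for parallel
    ones; no three become concurrent. From the second on, configurations for which this happens in
    every direction are let through. *)
Definition regular_direction t :=
  [/\ forall i, (i < n)%N -> forall k l, k *: v i = l *: direction t -> k = 0,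
      forall i, (i < n.+1)%N -> forall j, (j < n)%N ->
        det3 (c (S i) - u j) (v j) (direction t) != 0 \/
        forall w, det3 (c (S i) - u j) (v j) w = 0,
      forall i, (i < n)%N -> forall j, (j < n)%N ->
        det3 (v i) (v j) (direction t) != 0 \/ forall w, det3 (v i) (v j) w = 0,
      forall i, (i < n)%N -> forall j, (j < n)%N ->
        det3 (u i - u j) (v j) (direction t) != 0 \/
        forall w, det3 (u i - u j) (v j) w = 0 &
      forall i, (i < n)%N -> forall j, (j < n)%N -> forall k, (k < n)%N ->
        concurrency (u i) (v i) (u j) (v j) (u k) (v k) (direction t) != 0 \/
        forall w, concurrency (u i) (v i) (u j) (v j) (u k) (v k) w = 0].

Lemma exists_regular_direction : exists t, regular_direction t.
Proof.
have g1 := generic_forall (fun i ni => generic_not_parallel (v_neq0 ni)).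
have g2 := @generic_forall R n.+1 _ (fun i _ => @generic_forall R n _ (fun j _ =>
  generic_det3 (c (S i) - u j) (v j))).
have g3 := @generic_forall R n _ (fun i _ => @generic_forall R n _ (fun j _ =>
  generic_det3 (v i) (v j))).
have g4 := @generic_forall R n _ (fun i _ => @generic_forall R n _ (fun j _ =>
  generic_det3 (u i - u j) (v j))).
have g5 := @generic_forall R n _ (fun i _ => @generic_forall R n _ (fun j _ =>
  @generic_forall R n _ (fun k _ =>
  generic_concurrency (u i) (v i) (u j) (v j) (u k) (v k)))).
have [t [h1 [h2 [h3 [h4 h5]]]]] := generic_ex
  (generic_and g1 (generic_and g2 (generic_and g3 (generic_and g4 g5)))).
by exists t.
Qed.

Section Regular.
Variable tau : R.
Hypothesis reg : regular_direction tau.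
Let w := direction tau.
Let d t := shear tau (c t).
Let h t := height (c t).

Let locate t : t \in `[0, 1[ -> exists2 i, (i < n)%N & S i <= t <= S i.+1.
Proof.
rewrite in_itv /= => /andP[t0 t1].
by apply: locate_piece => //; rewrite S1 t0 ltW.
Qed.

Let no_parallel i k l : (i < n)%N -> k *: v i = l *: w -> l = 0.
Proof.
case: reg => g1 _ _ _ _ ni kl; move: (kl); rewrite (g1 i ni _ _ kl) scale0r => /esym/eqP.
by rewrite scaler_eq0 (negbTE (direction_neq0 _)) orbF => /eqP.
Qed.

Let double_height x y : double_point d x y -> h x != h y.
Proof.
move=> [x1 y1 xy /shear_eq cxy]; apply: contra_neq xy => hxy; apply: c_inj => //.
by apply/eqP; rewrite -subr_eq0 cxy -/(h x) -/(h y) hxy subrr scale0r.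
Qed.

Let double_gap x y : double_point d x y -> exists2 l, l != 0 & c x - c y = l *: w.
Proof.
move=> dxy; exists (h x - h y); first by rewrite subr_eq0 double_height.
by case: dxy => _ _ _ /shear_eq.
Qed.

Let double_sym x y : double_point d x y -> double_point d y x.
Proof. by move=> [x1 y1 xy dxy]; split => //; rewrite eq_sym. Qed.

(** Since the vertex falls on the projected line of the other strand, it lies on that line in space;
    the gap between the two points, along the projection direction, would then be parallel to a
    segment. *)
Lemma double_not_vertex x y : double_point d x y -> x \notin 0 :: s.
Proof.
move=> dxy; have [l l0 cxy] := double_gap dxy; apply/negP => /(nthP 0)[i].
rewrite ltnS -/S => si xE; have [_ y1 _ _] := dxy.
have [j nj yj] := locate y1; have cy := cuv nj yj.
have AE : c (S i) - u j = y *: v j + l *: w.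
  by rewrite xE -cxy cy; apply/rowP => m; rewrite !mxE; ring.
case: reg => _ g2 _ _ _; case: (g2 i si j nj) => [|all0].
  by rewrite AE det3_span eqxx.
have [k kE] := det3_parallel (v_neq0 nj) all0.
have : (k - y) *: v j = l *: w.
  by rewrite scalerBl -kE AE addrC addKr.
by move/(no_parallel nj)/eqP; rewrite (negbTE l0).
Qed.

(** Parallel segments meeting in projection have lines that fall together, so these lines coincide
    in space, and again the gap would be parallel to a segment. *)
Let skew x y i j : double_point d x y -> (i < n)%N -> S i <= x <= S i.+1 ->
  (j < n)%N -> S j <= y <= S j.+1 -> det3 (v i) (v j) w != 0.
Proof.
move=> dxy ni xi nj yj; have [l l0 cxy] := double_gap dxy.
case: reg => _ _ g3 g4 _; case: (g3 i ni j nj) => // all0.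
have [k vk] := det3_parallel (v_neq0 nj) all0.
have uE : u i - u j = (y - x * k) *: v j + l *: w.
  rewrite -cxy (cuv ni xi) (cuv nj yj) vk.
  by apply/rowP => m; rewrite !mxE; ring.
case: (g4 i ni j nj) => [|all0']; first by rewrite uE det3_span eqxx.
have [k' uk] := det3_parallel (v_neq0 nj) all0'.
have : (k' - (y - x * k)) *: v j = l *: w.
  by rewrite scalerBl -uk uE addrC addKr.
by move/(no_parallel nj)/eqP; rewrite (negbTE l0).
Qed.

Lemma double_finite : finite_set [set x | exists y, double_point d x y].
Proof.
pose D (ij : 'I_n * 'I_n) := [set x | S ij.1 <= x <= S ij.1.+1 /\
  exists2 y, S ij.2 <= y <= S ij.2.+1 & double_point d x y].
have D_unique ij x x' : D ij x -> D ij x' -> x = x'.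
  case: ij => i j [/= xi [y yj dxy]] [x'i [y' y'j dxy']].
  have [l _ cxy] := double_gap dxy; have [l' _ cxy'] := double_gap dxy'.
  have nz := skew dxy (ltn_ord i) xi (ltn_ord j) yj.
  apply/eqP; rewrite -subr_eq0; apply/eqP; apply: (mulIf nz); rewrite mul0r -det3Zl.
  (* Subtracting the two gap equations: a pair of skew pieces accounts for at most one double
     parameter on its first piece. *)
  suff -> : (x - x') *: v i = (y - y') *: v j + (l - l') *: w by rewrite det3_span.
  have := congr2 (fun p q => p - q) cxy cxy'.
  rewrite -scalerBl => <-; rewrite (cuv (ltn_ord i) xi) (cuv (ltn_ord j) yj).
  rewrite (cuv (ltn_ord i) x'i) (cuv (ltn_ord j) y'j).
  apply/rowP => m; rewrite !mxE; ring.
apply: (@sub_finite_set _ _ ((fun ij => xget 0 (D ij)) @` [set: 'I_n * 'I_n])).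
  move=> x [y dxy]; have [x1 y1 _ _] := dxy.
  have [i ni xi] := locate x1; have [j nj yj] := locate y1.
  have Dx : D (Ordinal ni, Ordinal nj) x by split => //; exists y.
  exists (Ordinal ni, Ordinal nj) => //.
  exact: D_unique (xgetPex 0 (ex_intro _ x Dx)) Dx.
by apply: finite_image; apply: finite_finset.
Qed.

(** Three strands over one point make [concurrency] vanish at the direction, hence everywhere.
    Skewness then forces the other two strands to have the same gap to the first, and they meet in
    space. *)
Lemma double_unique x y z : double_point d x y -> double_point d x z -> y = z.
Proof.
move=> dxy dxz; have [x1 y1 _ _] := dxy; have [_ z1 _ _] := dxz.
have [i ni xi] := locate x1; have [j nj yj] := locate y1; have [k nk zk] := locate z1.
have [l _ cyx] := double_gap (double_sym dxy).
have [m _ czx] := double_gap (double_sym dxz).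
have uiE : u i = c x - x *: v i by rewrite (cuv ni xi) addrK.
have ujE : u j = c x + l *: w - y *: v j.
  by rewrite -cyx [c x + _]addrC subrK (cuv nj yj) addrK.
have ukE : u k = c x + m *: w - z *: v k.
  by rewrite -czx [c x + _]addrC subrK (cuv nk zk) addrK.
case: reg => _ _ _ _ g5; case: (g5 i ni j nj k nk) => [|all0].
  by rewrite uiE ujE ukE concurrency_projected eqxx.
have lm : l = m.
  rewrite uiE ujE ukE in all0; apply: (concurrency_zero all0).
    exact: skew dxy ni xi nj yj.
  exact: skew (double_sym dxz) nk zk ni xi.
by apply: c_inj => //; rewrite -[c y](subrK (c x)) cyx lm -czx subrK.
Qed.

Let d_cont : {within `[0, 1], continuous d}.
Proof.
have [cc _ _] := c_simple; move=> x; have ccx := cc x.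
apply: cvgD; first exact: cvg_base ccx.
by apply: cvgZ; [exact: cvg_height ccx|exact: cvg_cst].
Qed.

Let d_closed : d 0 = d 1.
Proof. by rewrite /d; have [_ -> _] := c_simple. Qed.

Let d_segments : exists2 s' : seq R, size s' = n & affine_along s' d /\
  forall x y, double_point d x y -> x \notin 0 :: s'.
Proof.
exists s => //; split; last exact: double_not_vertex.
split; first by case: sc.
move=> i ni; exists (shear tau (u i)), (shear tau (v i)) => x xi.
rewrite /d (@cuv i x ni); last by move: xi; rewrite in_itv.
apply: vec_eq; rewrite /shear /base /height !mxE; ring.
Qed.

Let over_total x y : double_point d x y -> (h y < h x <-> ~ h x < h y).
Proof.
move=> /double_height hxy; split => [/ltW|/negP]; first by rewrite leNgt => /negP.
by rewrite -leNgt lt_neqAle eq_sym hxy.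
Qed.

Definition projection : pl_diagram R n :=
  @PlDiagram R n d (fun x y => h y < h x) d_cont d_closed d_segments double_unique
    double_finite over_total.

Lemma projection_represents : represents projection (c @` `[0, 1]).
Proof.
pose lift x := point (d x) (h x).
have [cc c01 _] := c_simple.
exists lift, h; split => //.
- split.
  + by move=> x; apply: cvg_point; [exact: d_cont|exact: cvg_height (cc x)].
  + by rewrite /lift d_closed /h c01.
  + move=> x y x1 y1 /point_inj[dxy hxy]; apply: c_inj => //.
    by apply/eqP; rewrite -subr_eq0 (shear_eq dxy) -/(h x) -/(h y) hxy subrr scale0r.
(* With [C = 0] and [k] the negation, each level [z] is translated by [z *: vec tau (tau ^+ 3)]: a
   linear shear of space taking the knot to the lift of its projection. *)
have := @level_isotopy R 0 (fun z => - z) (fun=> vec tau (tau ^+ 3)) (c @` `[0, 1]).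
have dot0 (p : 'rV[R]_2) : dot p 0 = 0 by rewrite -(scale0r 0) dotZr mul0r.
rewrite image_comp.
under [X in _ -> _ -> _ -> ambient_isotopic _ X]eq_imagel => x x01 /=.
  rewrite dot0 sub0r opprK; over.
apply; last by move=> z; rewrite dot0 addr0.
- by move=> z; apply: (@cvgN _ R^o); exact: cvg_id.
- exact: cst_continuous.
Qed.

End Regular.
End Pieces.

Lemma polygonal_represents :
  exists D : pl_diagram R n, represents D (c @` `[0, 1]).
Proof.
have [u [v cuv]] := affine_along_pieces sc; have [tau reg] := exists_regular_direction cuv.
by exists (projection cuv reg); apply: projection_represents.
Qed.

End Projection.

(** * From tame knots to diagrams, and from diagrams to foldings *)

Lemma tame_represents (R : realType) (K : set 'rV[R]_3) : tame_knot K ->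
  exists n (D : pl_diagram R n), represents D K.
Proof.
move=> [_ [L [b [b_simple [s sb]] ->] KL]].
have [D [c [h [c_simple ch over_h LC]]]] := polygonal_represents b_simple sb.
exists (size s), D, c, h; split => //.
exact: ambient_isotopic_trans KL LC.
Qed.

Lemma represents_fold (R : realType) n (D : pl_diagram R n) (K : set 'rV[R]_3) :
  represents D K -> exists F (G : straight_graph R) (L : set 'rV[R]_3),
  [/\ origami_folding F, crease_pattern F G, (size (edges G) <= n)%N, admits F L &
      ambient_isotopic K L].
Proof.
move=> [c [h [c_simple ch _ KC]]].
have [s sn [sd s_regular]] := curve_segments D.
have [a [e [V [g [arc CA]]]]] := diagram_arc sn sd s_regular c_simple ch.
have [F [G [L [FO FG Gn FL AL]]]] := arc_diagram_fold arc.
exists F, G, L; split => //.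
exact: ambient_isotopic_trans KC (ambient_isotopic_trans CA AL).
Qed.

Lemma exists_minimum (S : set nat) m : S m ->
  exists n, is_minimum S n /\ (n <= m)%N.
Proof.
move=> Sm; have exS : exists n, `[< S n >] by exists m; apply/asboolP.
exists (ex_minn exS); case: ex_minnP => n /asboolP Sn nmin.
by split; [split => // k Sk|]; apply: nmin; apply/asboolP.
Qed.

Theorem theorem1 (R : realType) :
  (forall K : set 'rV[R]_3, tame_knot K ->
     exists2 L : set 'rV[R]_3, origami_knot L & ambient_isotopic K L) /\
  (forall K : set 'rV[R]_3, tame_knot K ->
     exists f s : nat,
       [/\ is_fold_number K f, is_diagram_stick_number K s & (f <= s)%N]).
Proof.
split=> K /tame_represents[n [D DK]].
  have [F [G [L [FO _ _ FL KL]]]] := represents_fold DK.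
  by exists L => //; exists F.
(* The folding is built from a diagram with the least number of segments, so its crease count bounds
   the fold number by the stick number. *)
have [s [[[D' D'K] smin] _]] := @exists_minimum
  [set n | exists D : pl_diagram R n, represents D K] n (ex_intro _ D DK).
have [F [G [L [FO FG Gs FL KL]]]] := represents_fold D'K.
have [f [fmin fG]] := @exists_minimum [set n | exists F G (L : set 'rV[R]_3),
  [/\ origami_folding F, crease_pattern F G, size (edges G) = n,
      admits F L & ambient_isotopic K L]] (size (edges G))
  (ex_intro _ F (ex_intro _ G (ex_intro _ L (And5 FO FG erefl FL KL)))).
exists f, s; split => //; first by split => //; exists D'.
exact: leq_trans fG Gs.
Qed.
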